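(* Let $G$ be the split simply connected group of type $D_4$ over $k$, $V$ its 8-dimensional irreducible representation $\rho_0$ with highest weight $\omega_1$, $\Gamma_V$ the associated geometry of subspaces of $V$, and $\phi$ the automorphism of $G$ of order 3 induced by the diagram automorphism $\alpha_1\mapsto\alpha_3\mapsto\alpha_4\mapsto\alpha_1$ (fixing $\alpha_2$). Let $*$ be the product on $V$ described in the context. Define $\psi$ by $$\psi(ka) = a * V, \qquad \psi(a*V) = V * a, \qquad \psi(V * a) = ka$$ for $a\in V$ nonzero isotropic, and $$\psi(X) = X * (V * X)$$ for $X$ an $\alpha_2$-space. Then $\psi$ is a well-defined map on $\Gamma_V$, and it is the automorphism of the geometry $\Gamma_V$ induced by the automorphism $\phi$ of $G$.
   Context: $k$ is a field of characteristic zero. The Dynkin diagram $\Delta=\{\alpha_1,\alpha_2,\alpha_3,\alpha_4\}$ of $D_4$ has central vertex $\alpha_2$; $\omega_i$ is the fundamental weight corresponding to $\alpha_i$. $T\subset B$ are the standard split maximal torus and Borel subgroup, $\mathfrak X_\rho$ is the root subgroup of a root $\rho$, and $P_\delta$ ($\delta\in\Delta$) is the maximal parabolic generated by $B$ and the $\mathfrak X_{-\alpha}$, $\alpha\in\Delta\setminus\{\delta\}$. Let $v^+\in V$ be a highest weight vector. Put $V_{\alpha_1}=kv^+$. For $\delta\ne\alpha_1$, let $L_\delta$ be the subgroup generated by the $\mathfrak X_\rho$ for roots $\rho$ that are combinations of simple roots in the connected component of $\alpha_1$ in the diagram with $\delta$ removed, and let $V_\delta$ be the span of the $L_\delta$-orbit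 of $v^+$. The objects of $\Gamma_V$ are the subspaces $gV_\delta$ ($g\in G(k)$ acting via $\rho_0$, $\delta\in\Delta$); $gV_\delta$ is called a $\delta$-space, its stabilizer is $gP_\delta g^{-1}$, and sending an object to its stabilizer is a bijection onto the maximal proper parabolic subgroups of $G$. Two objects are incident if the intersection of their stabilizers contains a parabolic subgroup. The automorphism of $\Gamma_V$ induced by $\phi$ sends the object with stabilizer $P$ to the object with stabilizer $\phi(P)$. $\phi$ preserves $T$ and $B$ and sends $x_{\pm\alpha}(t)$ to $x_{\pm\phi(\alpha)}(t)$ for $\alpha\in\Delta$. Put $\rho_i:=\rho_0\phi^{-i}$ for $i=1,2$; these are representations of $G$ on the same space $V$, with highest weights $\omega_3$, $\omega_4$. $b$ is a nondegenerate $G$-invariant symmetric bilinear form on $V$ (unique up to scalar, and invariant under every $\rho_i(G)$); $a$ is isotropic if $b(a,a)=0$. There is a nonzero linear map $t\colon V\otimes V\otimes V\to k$, unique up to scalar, with $t(\rho_0(g)x_0,\rho_1(g)x_1,\rho_2(g)x_2)=t(x_0,x_1,x_2)$ for all $g\in G$; it is invariant under cyclic permutation of its arguments. The bilinear product $*$ on $V$ is defined by $t(x_0,x_1,x_2)=b(x_0,x_1*x_2)$. For subspaces $X,Y$ of $V$, $X*Y$ is the span of all $x*y$ with $x\in X$, $y\in Y$; $a*V$ and $V*a$ mean $(ka)*V$ and $V*(ka)$. *)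

(* Defs.v *)
From HB Require Import structures.
From mathcomp Require Import all_boot all_order all_algebra.

Set Implicit Arguments.
Unset Strict Implicit.
Unset Printing Implicit Defensive.

Import GRing.Theory.
Local Open Scope ring_scope.

(** * The root system D4 *)

Definition a1 : 'I_4 := @Ordinal 4 0 isT.
Definition a2 : 'I_4 := @Ordinal 4 1 isT.
Definition a3 : 'I_4 := @Ordinal 4 2 isT.
Definition a4 : 'I_4 := @Ordinal 4 3 isT.

(* alpha_1 -> alpha_3 -> alpha_4 -> alpha_1, alpha_2 -> alpha_2. *)
Definition diagram_aut (i : 'I_4) : 'I_4 := nth a2 [:: a3; a2; a4; a1] i.

Definition cartan (i j : 'I_4) : int :=
  if i == j then 2 else if (i == a2) || (j == a2) then -1 else 0.

(* An element of the root lattice is the row of its coordinates in the basis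
   of simple roots. *)
Notation rootlat := 'rV[int]_4.

Definition simple (i : 'I_4) : rootlat := delta_mx 0 i.

Definition pairing (r s : rootlat) : int :=
  \sum_i \sum_j r 0 i * cartan i j * s 0 j.

(* D4 is simply laced: its roots are the vectors of square length 2. *)
Definition is_root (r : rootlat) : bool := pairing r r == 2.

Definition positive (r : rootlat) : bool := is_root r && [forall i, 0 <= r 0 i].

(* Structure constants of a Chevalley basis: the sign
   eps(r,s) = (-1)^(sum_i r_i s_i + r_2 (s_1 + s_3 + s_4)) is bimultiplicative
   with eps(r,r) = (-1)^((r,r)/2), so [E_r,E_s] = eps(r,s) E_(r+s) and
   [E_r,E_(-r)] = - h_r define the Lie algebra of type D4; replacing E_r by
   - E_r for r negative turns the last relation into [e_r,e_(-r)] = h_r. *)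
Definition eps_exponent (r s : rootlat) : int :=
  (\sum_i r 0 i * s 0 i) + r 0 a2 * (s 0 a1 + s 0 a3 + s 0 a4).

Definition sgn_root (k : fieldType) (r : rootlat) : k :=
  if positive r then 1 else -1.

Definition struct_const (k : fieldType) (r s : rootlat) : k :=
  sgn_root k r * sgn_root k s * sgn_root k (r + s) * (-1) ^ eps_exponent r s.

(** * The split simply connected group, through its k-points *)

(* Below, [x r : k -> G] is the parametrization of the root subgroup
   of the root r; the values of [x] at non-roots are irrelevant. *)

Definition w_elt (k : fieldType) (G : groupType) (x : rootlat -> k -> G)
    (r : rootlat) (s : k) : G :=
  (x r s * x (- r)%R (- s^-1)%R * x r s)%g.

(* h_r(s) is the value at s of the coroot of r. *)
Definition h_elt (k : fieldType) (G : groupType) (x : rootlat -> k -> G)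
    (r : rootlat) (s : k) : G :=
  (w_elt x r s * (w_elt x r 1%R)^-1)%g.

Record steinberg_relations (k : fieldType) (G : groupType)
    (x : rootlat -> k -> G) : Prop := {
  steinberg_add : forall r s t, is_root r ->
    x r (s + t) = (x r s * x r t)%g;
  steinberg_comm : forall r r' s t, is_root r -> is_root r' ->
    is_root (r + r') ->
    [~ x r s, x r' t]%g = x (r + r') (struct_const k r r' * s * t);
  steinberg_commute : forall r r' s t, is_root r -> is_root r' ->
    r + r' != 0 -> ~~ is_root (r + r') -> commute (x r s) (x r' t);
  steinberg_torus : forall r s t, is_root r -> s != 0 -> t != 0 ->
    h_elt x r (s * t) = (h_elt x r s * h_elt x r t)%g
}.

Inductive generated (G : groupType) (S : G -> Prop) : G -> Prop :=
| gen_base g : S g -> generated S g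
| gen_one : generated S 1%g
| gen_mul g h : generated S g -> generated S h -> generated S (g * h)%g
| gen_inv g : generated S g -> generated S g^-1%g.

Definition root_elements (k : fieldType) (G : groupType)
    (x : rootlat -> k -> G) (Q : rootlat -> bool) (g : G) : Prop :=
  exists r s, [/\ is_root r, Q r & g = x r s].

(* By Steinberg's theorem the group of k-points of the split simply connected
   group of type D4, with its root subgroups, is the group presented by
   generators x_r(s), r a root and s in k, and the above relations. *)
Record split_simply_connected_D4 (k : fieldType) (G : groupType)
    (x : rootlat -> k -> G) : Prop := {
  sc_relations : steinberg_relations x;
  sc_generated : forall g, generated (root_elements x xpredT) g;
  sc_universal : forall (H : groupType) (y : rootlat -> k -> H),
    steinberg_relations y ->
    exists f : {multiplicative G -> H},
      forall r s, is_root r -> f (x r s) = y r s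
}.

Definition torus (k : fieldType) (G : groupType) (x : rootlat -> k -> G)
    : G -> Prop :=
  generated (fun g => exists i s, s != 0 /\ g = h_elt x (simple i) s).

Definition borel (k : fieldType) (G : groupType) (x : rootlat -> k -> G)
    : G -> Prop :=
  generated (fun g => torus x g \/ root_elements x positive g).

Definition subgroup (G : groupType) (P : G -> Prop) : Prop :=
  [/\ P 1%g, forall g h, P g -> P h -> P (g * h)%g & forall g, P g -> P g^-1%g].

Definition parabolic (k : fieldType) (G : groupType) (x : rootlat -> k -> G)
    (P : G -> Prop) : Prop :=
  subgroup P /\ exists g, forall h, borel x h -> P (g * h * g^-1)%g.

Record triality (k : fieldType) (G : groupType) (x : rootlat -> k -> G)
    (phi : {multiplicative G -> G}) : Prop := {
  triality_order3 : forall g, phi (phi (phi g)) = g;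
  triality_pos : forall i s,
    phi (x (simple i) s) = x (simple (diagram_aut i)) s;
  triality_neg : forall i s,
    phi (x (- simple i) s) = x (- simple (diagram_aut i)) s
}.

(** * Representations *)

Definition representation (k : fieldType) (G : groupType) (V : vectType k)
    (rho : G -> 'End(V)) : Prop :=
  rho 1%g = \1%VF /\ forall g h, rho (g * h)%g = (rho g \o rho h)%VF.

(* The root subgroups generate G, and the product of the x_r for r negative,
   the coroots of the simple roots and the x_r for r positive is an open
   immersion: a homomorphism is a morphism of varieties as soon as it is
   polynomial on each root subgroup. *)
Definition rational (k : fieldType) (G : groupType) (x : rootlat -> k -> G)
    (V : vectType k) (rho : G -> 'End(V)) : Prop :=
  forall r, is_root r -> exists n (A : nat -> 'End(V)),
    forall s, rho (x r s) = \sum_(i < n) s ^+ i *: A i.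

Definition irreducible (k : fieldType) (G : groupType) (V : vectType k)
    (rho : G -> 'End(V)) : Prop :=
  {:V}%VS != 0%VS /\
  forall U : {vspace V}, (forall g, (rho g @: U <= U)%VS) ->
    U = 0%VS \/ U = {:V}%VS.

(* The weight is given by its coordinates in the basis of fundamental weights,
   that is by its values on the simple coroots. *)
Definition highest_weight_vector (k : fieldType) (G : groupType)
    (x : rootlat -> k -> G) (V : vectType k) (rho : G -> 'End(V))
    (m : 'I_4 -> nat) (v : V) : Prop :=
  [/\ v != 0,
      forall r s, positive r -> rho (x r s) v = v
    & forall i s, s != 0 -> rho (h_elt x (simple i) s) v = s ^+ m i *: v].

Definition fundamental_weight (j i : 'I_4) : nat := (i == j).

(* [phiV] is meant to be the inverse of phi: this is rho o phi^(-i). *)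
Definition twist (k : fieldType) (G : groupType) (V : vectType k)
    (rho : G -> 'End(V)) (phiV : G -> G) (i : nat) (g : G) : 'End(V) :=
  rho (iter i phiV g).

(** * The geometry *)

Definition is_span (k : fieldType) (V : vectType k) (S : V -> Prop)
    (U : {vspace V}) : Prop :=
  (forall v, S v -> v \in U) /\
  forall W : {vspace V}, (forall v, S v -> v \in W) -> (U <= W)%VS.

(* The connected component of alpha_1 in the diagram with delta removed,
   for delta != a1. *)
Definition component (delta : 'I_4) : pred 'I_4 :=
  connect (fun i j => [&& i != delta, j != delta & cartan i j != 0]) a1.

Definition levi (k : fieldType) (G : groupType) (x : rootlat -> k -> G)
    (delta : 'I_4) : G -> Prop :=
  generated (root_elements x
    (fun r => [forall i, (r 0 i != 0) ==> component delta i])).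

Definition standard_space (k : fieldType) (G : groupType)
    (x : rootlat -> k -> G) (V : vectType k) (rho : G -> 'End(V)) (v : V)
    (delta : 'I_4) (U : {vspace V}) : Prop :=
  if delta == a1 then U = <[v]>%VS
  else is_span (fun u => exists2 g, levi x delta g & u = rho g v) U.

Definition delta_space (k : fieldType) (G : groupType)
    (x : rootlat -> k -> G) (V : vectType k) (rho : G -> 'End(V)) (v : V)
    (delta : 'I_4) (X : {vspace V}) : Prop :=
  exists g U, standard_space x rho v delta U /\ X = (rho g @: U)%VS.

Definition object (k : fieldType) (G : groupType)
    (x : rootlat -> k -> G) (V : vectType k) (rho : G -> 'End(V)) (v : V)
    (X : {vspace V}) : Prop :=
  exists delta, delta_space x rho v delta X.

Definition stabilizer (k : fieldType) (G : groupType) (V : vectType k)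
    (rho : G -> 'End(V)) (X : {vspace V}) (g : G) : Prop :=
  (rho g @: X)%VS = X.

Definition incident (k : fieldType) (G : groupType) (x : rootlat -> k -> G)
    (V : vectType k) (rho : G -> 'End(V)) (X Y : {vspace V}) : Prop :=
  exists P : G -> Prop, parabolic x P /\
    forall g, P g -> stabilizer rho X g /\ stabilizer rho Y g.

(* Maps on the set of objects [Gam] are given by their graphs. *)

Definition is_map_on (T : Type) (Gam : T -> Prop) (R : T -> T -> Prop) : Prop :=
  (forall X Y, R X Y -> Gam X /\ Gam Y) /\
  (forall X, Gam X -> exists! Y, R X Y).

Definition is_geometry_automorphism (T : Type) (Gam : T -> Prop)
    (inc : T -> T -> Prop) (R : T -> T -> Prop) : Prop :=
  [/\ is_map_on Gam R,
      forall Y, Gam Y -> exists! X, R X Y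
    & forall X X' Y Y', R X Y -> R X' Y' -> (inc X X' <-> inc Y Y')].

(* The graph of the map sending the object with stabilizer P to the object
   with stabilizer phi(P). *)
Definition induced_graph (k : fieldType) (G : groupType)
    (x : rootlat -> k -> G) (V : vectType k) (rho : G -> 'End(V)) (v : V)
    (phi : G -> G) (X Y : {vspace V}) : Prop :=
  [/\ object x rho v X, object x rho v Y
    & forall g, stabilizer rho Y g <->
                exists2 h, stabilizer rho X h & g = phi h].

(** * The product and the map psi *)

Definition trilinear (k : fieldType) (V : vectType k) (t : V -> V -> V -> k)
    : Prop :=
  [/\ forall y z, scalar (fun x => t x y z),
      forall x z, scalar (fun y => t x y z)
    & forall x y, scalar (fun z => t x y z)].

Definition nondegenerate_form (k : fieldType) (V : vectType k)
    (b : V -> V -> k) : Prop :=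
  forall x, (forall y, b x y = 0) -> x = 0.

(* X * Y, computed on bases; by [spprodP] it is the span of all products. *)
Definition spprod (k : fieldType) (V : vectType k)
    (star : {bilinear V -> V -> V}) (X Y : {vspace V}) : {vspace V} :=
  <<[seq star u v | u <- vbasis X, v <- vbasis Y]>>%VS.

Lemma spprodP (k : fieldType) (V : vectType k)
    (star : {bilinear V -> V -> V}) (X Y : {vspace V}) :
  is_span (fun z => exists u v, [/\ u \in X, v \in Y & z = star u v])
          (spprod star X Y).
Proof.
split=> [z [u [v [uX vY ->]]] | W hW].
  rewrite (coord_vbasis uX) (coord_vbasis vY) linear_sumlz; apply: memv_suml.
  move=> i _; rewrite linear_sumr; apply: memv_suml => j _.
  rewrite linearZl_LR linearZr_LR !memvZ //; apply: memv_span.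
  by apply: allpairs_f; apply: mem_nth; rewrite size_tuple.
apply/span_subvP => _ /allpairsP[[u v] /= [uX vY ->]].
by apply: hW; exists u, v; rewrite !(vbasis_mem uX, vbasis_mem vY).
Qed.

Inductive psi_graph (k : fieldType) (G : groupType) (x : rootlat -> k -> G)
    (V : vectType k) (rho : G -> 'End(V)) (v : V) (b : V -> V -> k)
    (star : {bilinear V -> V -> V}) : {vspace V} -> {vspace V} -> Prop :=
| psi_line a of a != 0 & b a a = 0 :
    psi_graph x rho v b star <[a]>%VS (spprod star <[a]> {:V})
| psi_left a of a != 0 & b a a = 0 :
    psi_graph x rho v b star (spprod star <[a]> {:V}) (spprod star {:V} <[a]>)
| psi_right a of a != 0 & b a a = 0 :
    psi_graph x rho v b star (spprod star {:V} <[a]>) <[a]>%VS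
| psi_plane X of delta_space x rho v a2 X :
    psi_graph x rho v b star X (spprod star X (spprod star {:V} X)).

(* Main.v *)
Require Import Defs.
From HB Require Import structures.
From mathcomp Require Import all_boot all_order all_algebra.
From mathcomp Require Import zify ring.
Import GRing.Theory.
Import Order.TTheory Num.Theory.
Local Open Scope ring_scope.

Set Implicit Arguments.
Unset Strict Implicit.
Unset Printing Implicit Defensive.

(* The root elements act polynomially, so they are exponentials, and comparing
   coefficients in Steinberg's relations turns V into a representation of the
   Lie algebra. The Serre relations, applied to the highest weight vector, then
   give an explicit basis e_0, ..., e_7 of V in which the simple root vectors
   are 0-1 matrices. In this basis b and * are determined up to a scalar by
   their infinitesimal invariance.
     Invariance of t amounts to rho(phi g) (x * y) = rho(g) x * rho(phi^-1 g) y,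
   so that psi (g X) = phi(g) psi(X): it suffices to compute psi on the standard
   spaces, where psi (V_d) = V_(phi d) can be read off the table of *, to know
   that the isotropic lines form one orbit, and to know that an object is
   determined by its stabilizer. For the last point, B fixes no totally isotropic
   subspaces of dimension 1, 2, 4 other than the standard spaces. That phi maps
   the stabilizer of V_d into that of V_(phi d) is clear from psi if d is a1 or
   a2; in the remaining cases e_0 is recovered from e_0 * V or V * e_0 as a
   generator of its right, resp. left, annihilator. *)

(** * The root system *)

(** [G] is an abstract group known by generators and relations, so no Lie algebra comes with it. The
    substitute is that in characteristic zero a polynomial in [s] is determined by its values at
    nonzero [s]: every relation between root elements becomes an identity between coefficients.
    Steinberg's relations contain no commutator formula for opposite roots, so [X_i, Y_i] is not
    directly accessible. On the highest weight vector it is found from the action of the torus, by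
    unfolding h_i(s) into root elements; elsewhere its bracket with a neighbouring Y_j suffices, and
    this passes through the root vector of -(a_i + a_j). Linear independence of the eight vectors
    comes from irreducibility and the dimension: their span is invariant, hence equal to V. Because
    objects are separated by their stabilizers, single-valuedness and injectivity of psi and its
    agreement with the induced map all become statements about stabilizers. There the order 3 of phi
    gives the reverse inclusions: its inverse is its square, so inclusions around a cycle of the
    diagram are equalities. *)

Lemma I4P (P : 'I_4 -> Prop) : P a1 -> P a2 -> P a3 -> P a4 -> forall i, P i.
Proof.
move=> P1 P2 P3 P4 [[|[|[|[|i]]]] lti] //;
  by [rewrite (_ : Ordinal lti = a1); last exact: val_inj
     |rewrite (_ : Ordinal lti = a2); last exact: val_inj
     |rewrite (_ : Ordinal lti = a3); last exact: val_inj
     |rewrite (_ : Ordinal lti = a4); last exact: val_inj].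
Qed.

Lemma sum_I4 (M : nmodType) (F : 'I_4 -> M) :
  \sum_i F i = F a1 + F a2 + F a3 + F a4.
Proof.
rewrite !big_ord_recl big_ord0 addr0 !addrA.
by do !congr (_ + _); congr F; apply: val_inj.
Qed.

(** Half the square length of a lattice vector; [q] is the coordinate at the central vertex. *)
Definition norm4 (p q u w : int) : int :=
  p * p + q * q + u * u + w * w - q * (p + u + w).

Lemma pairingE r s : pairing r s =
  2 * (r 0 a1 * s 0 a1 + r 0 a2 * s 0 a2 + r 0 a3 * s 0 a3 + r 0 a4 * s 0 a4)
  - r 0 a2 * (s 0 a1 + s 0 a3 + s 0 a4) - s 0 a2 * (r 0 a1 + r 0 a3 + r 0 a4).
Proof. rewrite /pairing !sum_I4 /cartan /=; ring. Qed.

Lemma is_rootE r : is_root r =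
  (norm4 (r 0 a1) (r 0 a2) (r 0 a3) (r 0 a4) == 1).
Proof. by rewrite /is_root pairingE /norm4; apply/eqP/eqP; lia. Qed.

Lemma positiveE r : positive r =
  [&& is_root r, 0 <= r 0 a1, 0 <= r 0 a2, 0 <= r 0 a3 & 0 <= r 0 a4].
Proof.
rewrite /positive; congr (_ && _); apply/forallP/and4P => [h|[h1 h2 h3 h4]].
  by split.
exact: I4P.
Qed.

Lemma simpleE i j : simple i 0 j = (i == j)%:R.
Proof. by rewrite mxE eqxx eq_sym. Qed.

(** Completing squares: 4 [norm4] = (2p-q)^2 + (2u-q)^2 + (2w-q)^2 + q^2, so each of the four
    squares is at most 4. *)
Lemma norm4_bound (p q u w : int) : norm4 p q u w = 1 ->
  [/\ -2 <= p <= 2, -2 <= q <= 2, -2 <= u <= 2 & -2 <= w <= 2].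
Proof.
rewrite /norm4 => h.
have sq (z : int) : 0 <= z * z by rewrite -expr2 sqr_ge0.
have bd (z : int) : z * z <= 4 -> -2 <= z <= 2 by nia.
have := sq (2 * p - q); have := sq (2 * u - q); have := sq (2 * w - q).
have := sq q => sq0 sw su sp.
have hq : -2 <= q <= 2 by apply: bd; lia.
have hp : -2 <= 2 * p - q <= 2 by apply: bd; lia.
have hu : -2 <= 2 * u - q <= 2 by apply: bd; lia.
have hw : -2 <= 2 * w - q <= 2 by apply: bd; lia.
by split=> //; lia.
Qed.

Definition ints2 : seq int := [:: -2; -1; 0; 1; 2].

Lemma ints2P (z : int) : (-2 <= z <= 2) = (z \in ints2).
Proof. by rewrite !inE; apply/idP/idP; lia. Qed.

(** By the bound, a decidable property of roots can be checked by evaluation on 5^4 quadruples. *)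
Lemma norm4_ind (P : int -> int -> int -> int -> bool) :
  all (fun p => all (fun q => all (fun u => all (fun w =>
    (norm4 p q u w == 1) ==> P p q u w) ints2) ints2) ints2) ints2 ->
  forall p q u w, norm4 p q u w = 1 -> P p q u w.
Proof.
move=> h p q u w n1; have [] := norm4_bound n1.
rewrite !ints2P => hp hq hu hw.
by have /allP/(_ _ hp)/allP/(_ _ hq)/allP/(_ _ hu)/allP/(_ _ hw) := h;
  rewrite n1 eqxx.
Qed.

Lemma root_sign r : is_root r -> positive r \/ positive (- r).
Proof.
rewrite is_rootE => /[dup] rr /eqP n1.
pose P (p q u w : int) := [&& 0 <= p, 0 <= q, 0 <= u & 0 <= w] ||
   [&& p <= 0, q <= 0, u <= 0 & w <= 0].
have := @norm4_ind P isT _ _ _ _ n1.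
rewrite /P => /orP[] h; [left|right]; rewrite positiveE is_rootE.
  by rewrite rr.
by rewrite !mxE !oppr_ge0 h andbT -(eqP rr) /norm4; apply/eqP; ring.
Qed.

Lemma positive_opp r : positive r -> ~~ positive (- r).
Proof.
rewrite !positiveE => /andP[rr h]; apply/negP => /andP[_ /and4P h']; case/and4P: h => ? ? ? ?.
have [h1 h2 h3 h4] : [/\ r 0 a1 = 0, r 0 a2 = 0, r 0 a3 = 0 & r 0 a4 = 0].
  by case: h'; rewrite !mxE !oppr_ge0 => ? ? ? ?; split; apply: le_anti; apply/andP.
by move: rr; rewrite is_rootE h1 h2 h3 h4.
Qed.

(** The second alternative is what makes induction on the height possible. *)
Lemma positive_descent r : positive r ->
  (exists i, r = simple i) \/
  exists2 i, positive (r - simple i) & 0 < r 0 i.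
Proof.
rewrite positiveE is_rootE => /andP[/eqP n1 rp].
pose P (p q u w : int) := [&& 0 <= p, 0 <= q, 0 <= u & 0 <= w] ==>
   [|| [&& p == 1, q == 0, u == 0 & w == 0], [&& p == 0, q == 1, u == 0 & w == 0],
       [&& p == 0, q == 0, u == 1 & w == 0], [&& p == 0, q == 0, u == 0 & w == 1],
       (0 < p) && (norm4 (p - 1) q u w == 1), (0 < q) && (norm4 p (q - 1) u w == 1),
       (0 < u) && (norm4 p q (u - 1) w == 1) | (0 < w) && (norm4 p q u (w - 1) == 1)].
have := @norm4_ind P isT _ _ _ _ n1.
rewrite /P rp /=.
have eqs i : (forall j, r 0 j = (i == j)%:R) -> r = simple i.
  by move=> h; apply/rowP => j; rewrite h simpleE.
have pos i : is_root (r - simple i) -> 0 < r 0 i -> positive (r - simple i).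
  move=> h1 h2; rewrite /positive h1; apply/forallP => j.
  rewrite !mxE eqxx /=; case: eqP => [->|_] /=; first by lia.
  by rewrite subr0; move: j; apply: I4P; lia.
case/or4P => [/and4P[/eqP h1 /eqP h2 /eqP h3 /eqP h4]
             |/and4P[/eqP h1 /eqP h2 /eqP h3 /eqP h4]
             |/and4P[/eqP h1 /eqP h2 /eqP h3 /eqP h4]|].
- by left; exists a1; apply: eqs; apply: I4P.
- by left; exists a2; apply: eqs; apply: I4P.
- by left; exists a3; apply: eqs; apply: I4P.
case/orP => [/and4P[/eqP h1 /eqP h2 /eqP h3 /eqP h4]|].
  by left; exists a4; apply: eqs; apply: I4P.
case/or4P => /andP[h0 h]; right; [exists a1 => //|exists a2 => //|exists a3 => //|exists a4 => //];
  apply: pos => //; by rewrite is_rootE !mxE /= !subr0.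
Qed.

Definition height (r : rootlat) : int := r 0 a1 + r 0 a2 + r 0 a3 + r 0 a4.

Lemma positive_ind (P : rootlat -> Prop) :
  (forall i, P (simple i)) ->
  (forall r i, positive r -> positive (r + simple i) -> P r ->
     P (r + simple i)) ->
  forall r, positive r -> P r.
Proof.
move=> P1 P2 r; have [n] := ubnP `|height r|%N; elim: n r => // n IH r hn pr.
case: (positive_descent pr) => [[i ->] //|[i pri hi]].
rewrite -(subrK (simple i) r); apply: P2 => //; first by rewrite subrK.
apply: IH => //; move: pr; rewrite positiveE => /and5P[_ ? ? ? ?].
have -> : height (r - simple i) = height r - 1.
  by rewrite /height !mxE; move: (i); apply: I4P => /=; ring.
have : 0 < height r by rewrite /height; move: (i) hi; apply: I4P; lia.
by lia.
Qed.

(** * Subgroups generated by root subgroups *)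

Lemma struct_const_sqr (k : fieldType) r s :
  struct_const k r s * struct_const k r s = 1.
Proof.
have sgn2 t : sgn_root k t * sgn_root k t = 1.
  by rewrite /sgn_root; case: ifP; rewrite ?mulrNN mulr1.
rewrite /struct_const; set e := eps_exponent r s.
have e2 : (-1 : k) ^ e * (-1) ^ e = 1.
  by rewrite -expfzMl mulrNN mulr1 exp1rz.
by rewrite mulrACA e2 mulr1 mulrACA sgn2 mulr1 mulrACA !sgn2 mulr1.
Qed.

Lemma is_root_simple i : is_root (simple i).
Proof. by rewrite is_rootE; move: i; apply: I4P; rewrite !simpleE. Qed.

Lemma is_rootN r : is_root (- r) = is_root r.
Proof. by rewrite !is_rootE !mxE /norm4; congr (_ == _); ring. Qed.

Lemma positive_root r : positive r -> is_root r.
Proof. by case/andP. Qed.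

Lemma positive_simple i : positive (simple i).
Proof.
by rewrite positiveE is_root_simple; move: i; apply: I4P; rewrite !simpleE.
Qed.

Section Subgroups.
Variables (k : fieldType) (G : groupType) (x : rootlat -> k -> G).
Hypothesis xrel : steinberg_relations x.
Variables (S : G -> Prop) (S_sub : subgroup S).

Lemma subgroup_comm g h : S g -> S h -> S [~ g, h]%g.
Proof.
case: S_sub => _ SM SV Sg Sh; rewrite commgEl /conjg.
by apply: (SM) (SV _ Sg) (SM _ _ (SV _ Sh) (SM _ _ Sg Sh)).
Qed.

(** The structure constants are signs, so each element of the root subgroup of [r + r'] is itself a
    commutator: the parameter absorbs the sign. *)
Lemma subgroup_root_add r r' : is_root r -> is_root r' -> is_root (r + r') ->
  (forall s, S (x r s)) -> (forall s, S (x r' s)) -> forall s, S (x (r + r') s).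
Proof.
move=> rr rr' rrr' Sr Sr' s.
have := subgroup_comm (Sr (struct_const k r r' * s)) (Sr' 1).
by rewrite (steinberg_comm xrel) // mulrA struct_const_sqr mul1r mulr1.
Qed.

(** The predicate [I] bounds the support of the root, so that the lemma serves both the whole group
    and its Levi subgroups. Along the induction supports only grow, the coefficients being
    nonnegative. *)
Lemma subgroup_pos (I : pred 'I_4) :
  (forall i, I i -> forall s, S (x (simple i) s)) ->
  forall r, positive r -> (forall i, r 0 i != 0 -> I i) -> forall s, S (x r s).
Proof.
move=> SI; apply: positive_ind => [i supp|r i pr pri IH supp].
  by apply: SI; apply: supp; rewrite simpleE eqxx.
apply: subgroup_root_add; rewrite ?(positive_root, positive_simple) //.
  apply: IH => j hj; apply: supp; rewrite mxE simpleE.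
  case/andP: pr => _ /forallP/(_ j); move: hj; case: (i == j) => /=; lia.
apply: SI; apply: supp; rewrite mxE simpleE eqxx.
by case/andP: pr => _ /forallP/(_ i) /=; lia.
Qed.

Lemma subgroup_neg (I : pred 'I_4) :
  (forall i, I i -> forall s, S (x (- simple i) s)) ->
  forall r, positive r -> (forall i, r 0 i != 0 -> I i) ->
  forall s, S (x (- r) s).
Proof.
move=> SI; apply: positive_ind => [i supp|r i pr pri IH supp].
  by apply: SI; apply: supp; rewrite simpleE eqxx.
rewrite opprD; apply: subgroup_root_add;
  rewrite -?opprD ?is_rootN ?(positive_root, positive_simple) //.
  apply: IH => j hj; apply: supp; rewrite mxE simpleE.
  case/andP: pr => _ /forallP/(_ j); move: hj; case: (i == j) => /=; lia.
apply: SI; apply: supp; rewrite mxE simpleE eqxx.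
by case/andP: pr => _ /forallP/(_ i) /=; lia.
Qed.

Lemma subgroup_roots (I : pred 'I_4) :
  (forall i, I i -> forall s, S (x (simple i) s)) ->
  (forall i, I i -> forall s, S (x (- simple i) s)) ->
  forall r, is_root r -> (forall i, r 0 i != 0 -> I i) -> forall s, S (x r s).
Proof.
move=> Sp Sn r /root_sign[] pr supp; first exact: (@subgroup_pos I).
rewrite -(opprK r); apply: (@subgroup_neg I) => // i.
by rewrite mxE oppr_eq0; apply: supp.
Qed.

Lemma generated_sub (A : G -> Prop) :
  (forall g, A g -> S g) -> forall g, generated A g -> S g.
Proof.
by case: S_sub => S1 SM SV AS g; elim=> //; [move=> *; apply: SM|move=> *; apply: SV].
Qed.

End Subgroups.

Section Relations.
Variables (k : fieldType) (G : groupType) (x : rootlat -> k -> G).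
Hypothesis xrel : steinberg_relations x.

Lemma root_elt0 r : is_root r -> x r 0 = 1%g.
Proof.
by move=> rr; apply: (@mulgI _ (x r 0)); rewrite -(steinberg_add xrel) // addr0 mulg1.
Qed.

Lemma root_eltN r s : is_root r -> x r (- s) = (x r s)^-1%g.
Proof.
move=> rr; apply: (@mulgI _ (x r s)).
by rewrite -(steinberg_add xrel) // subrr root_elt0 // mulgV.
Qed.

(** Reduces a property of all of [G] to the simple roots and their opposites, the only root elements
    whose action is computed. *)
Lemma generated_simple : (forall g, generated (root_elements x xpredT) g) ->
  forall S : G -> Prop, subgroup S ->
  (forall i s, S (x (simple i) s)) -> (forall i s, S (x (- simple i) s)) ->
  forall g, S g.
Proof.
move=> xgen S Ssub Sp Sn g; apply: (generated_sub Ssub _ (xgen g)) => _ [r [s [rr _ ->]]].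
by apply: (subgroup_roots xrel Ssub (I := xpredT)) => // i _; auto.
Qed.
End Relations.

(** * Polynomial one-parameter subgroups *)

Definition vpoly (k : fieldType) (W : lmodType k) (n : nat) (a : nat -> W) (s : k) : W :=
  \sum_(i < n) s ^+ i *: a i.

Section VectorPolynomials.
Variables (k : fieldType) (char_k : [pchar k] =i pred0).

Lemma natr_eq0_char0 n : (n%:R == 0 :> k) = (n == 0%N).
Proof. by move: n; apply/pcharf0P. Qed.

(** The value at 0 is left out because the torus identities hold for nonzero [s] only; the roots 1,
    2, 3, ... are distinct in characteristic zero and more numerous than the degree allows. *)
Lemma poly_eq0 (p : {poly k}) : (forall s, s != 0 -> p.[s] = 0) -> p = 0.
Proof.
move=> hp; pose rs : seq k := [seq i.+1%:R | i <- iota 0 (size p)].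
apply: (@roots_geq_poly_eq0 _ p rs); last by rewrite size_map size_iota.
  apply/allP => _ /mapP[i _ ->]; apply/rootP/hp.
  by rewrite natr_eq0_char0.
rewrite map_inj_uniq ?iota_uniq // => i j /eqP.
wlog lij : i j / (i <= j)%N => [h|].
  by case: (leqP i j) => [|/ltnW] le; [|rewrite eq_sym => /(h _ _ le)]; auto.
by rewrite eq_sym -subr_eq0 -natrB // natr_eq0_char0 subn_eq0 => le; lia.
Qed.

Variable W : vectType k.
Implicit Types a b : nat -> W.

Lemma vpoly_eq0 n a : (forall s, s != 0 -> vpoly n a s = 0) ->
  forall i, (i < n)%N -> a i = 0.
Proof.
move=> h i lin; rewrite (coord_vbasis (memvf (a i))) big1 // => j _.
pose p := \poly_(l < n) coord (vbasis fullv) j (a l).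
have p0 : p = 0.
  apply: poly_eq0 => s s0; rewrite horner_poly.
  have := congr1 (coord (vbasis fullv) j) (h s s0).
  rewrite /vpoly linear_sum linear0 => e; rewrite -[RHS]e; apply: eq_bigr => l _.
  by rewrite linearZ /= mulrC.
by have := coef_poly n (fun l => coord (vbasis fullv) j (a l)) i;
  rewrite -/p p0 coef0 lin => <-; rewrite scale0r.
Qed.

Lemma vpoly_widen m n a s : (forall i, (n <= i)%N -> a i = 0) -> (n <= m)%N ->
  vpoly m a s = vpoly n a s.
Proof.
move=> a0 le; rewrite /vpoly (big_ord_widen _ (fun i => s ^+ i *: a i) le) [RHS]big_mkcond /=.
by apply: eq_bigr => i _; case: ltnP => // /a0 ->; rewrite scaler0.
Qed.

Lemma vpoly_inj n m a b : (forall i, (n <= i)%N -> a i = 0) ->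
  (forall i, (m <= i)%N -> b i = 0) ->
  (forall s, s != 0 -> vpoly n a s = vpoly m b s) -> forall i, a i = b i.
Proof.
move=> a0 b0 eab i; apply/eqP; rewrite -subr_eq0; apply/eqP.
case: (ltnP i (maxn n m)) => [|]; last first.
  by rewrite geq_max => /andP[/a0 -> /b0 ->]; rewrite subrr.
move: i; apply: vpoly_eq0 => s s0.
rewrite /vpoly; under eq_bigr do rewrite scalerBr.
rewrite sumrB -!/(vpoly _ _ s) (vpoly_widen _ a0) ?leq_maxl //.
by rewrite (vpoly_widen _ b0) ?leq_maxr // eab // subrr.
Qed.

(* The hypothesis is that of a vector of weight m, for the root subgroups of a
   root and of its opposite. *)
Lemma vpoly_inv n m a b : (forall i, (n <= i)%N -> a i = 0) ->
  (forall i, (n <= i)%N -> b i = 0) ->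
  (forall s, s != 0 -> s ^+ m *: vpoly n b s^-1 = vpoly n a s) ->
  forall j, b j = if (j <= m)%N then a (m - j)%N else 0.
Proof.
move=> a0 b0 eab j.
(* Both sides are multiplied by [s ^+ n] to clear denominators: [b'] lists the coefficients of
   s^(n+m) b(1/s), and [a'] those of s^n a(s). *)
pose b' l := if (l <= n + m)%N then b (n + m - l)%N else 0.
pose a' l := if (n <= l)%N then a (l - n)%N else 0.
have ab' l : b' l = a' l.
  apply: (@vpoly_inj (n + m).+1 (n + n)) => {l} [l ln|l ln|s s0].
  - by rewrite /b' leqNgt ln.
  - by rewrite /a' a0 ?if_same //; lia.
  transitivity (s ^+ n *: vpoly n a s).
    rewrite -eab // scalerA -exprD -(vpoly_widen (m := (n + m).+1) _ b0); last by lia.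
    rewrite /vpoly scaler_sumr (reindex_inj rev_ord_inj) /=.
    apply: eq_bigr => i _; have le_i : (i <= n + m)%N by rewrite -ltnS.
    by rewrite scalerA /b' subSS leq_subr (subKn le_i) exprVn expfB_cond ?(negPf s0).
  rewrite /vpoly big_split_ord /= [X in _ = X + _]big1 ?add0r => [|i _]; last first.
    by rewrite /a' leqNgt ltn_ord scaler0.
  rewrite scaler_sumr; apply: eq_bigr => i _.
  by rewrite /a' leq_addr addKn exprD scalerA.
case: (ltnP (n + m) j) => [jn|jn].
  by rewrite b0 ?ifN //; lia.
have := ab' (n + m - j)%N; rewrite /a' /b' leq_subr subKn // => ->.
by case: (leqP j m) => jm; [rewrite ifT; [congr a|] | rewrite ifN //]; lia.
Qed.

Lemma vpoly_linear (W' : lmodType k) (f : {linear W -> W'}) n a s :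
  f (vpoly n a s) = vpoly n (f \o a) s.
Proof. by rewrite linear_sum; apply: eq_bigr => i _; rewrite linearZ. Qed.

Lemma vpoly_const n a : (forall i, (n <= i)%N -> a i = 0) -> vpoly n a 0 = a 0%N.
Proof.
move=> a0; rewrite -(vpoly_widen (m := n.+1) _ a0) //.
rewrite /vpoly big_ord_recl expr0 scale1r big1 ?addr0 // => i _.
by rewrite expr0n scale0r.
Qed.
End VectorPolynomials.

(** The coefficient sequence is extended by zero beyond [n], so that it depends on [F] alone and two
    such sequences can be compared at every index. *)
Definition has_coefs (k : fieldType) (W : lmodType k) (F : k -> W) (a : nat -> W) :=
  exists n, (forall i, (n <= i)%N -> a i = 0) /\ forall s, F s = vpoly n a s.

Section Coefficients.
Variables (k : fieldType) (char_k : [pchar k] =i pred0).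
Section VectorSpace.
Variable V : vectType k.

Lemma has_coefs_inj (F F' : k -> V) a a' : has_coefs F a -> has_coefs F' a' ->
  (forall s, s != 0 -> F s = F' s) -> forall i, a i = a' i.
Proof.
case=> n [a0 Fa] [m [a0' Fa']] eF; apply: (vpoly_inj char_k a0 a0') => s s0.
by rewrite -Fa -Fa' eF.
Qed.

Lemma has_coefs0 (F : k -> V) a : has_coefs F a -> a 0%N = F 0.
Proof. by case=> n [a0 ->]; rewrite vpoly_const. Qed.

Lemma has_coefs_linear (W : lmodType k) (f : {linear V -> W}) (F : k -> V) a :
  has_coefs F a -> has_coefs (f \o F) (f \o a).
Proof.
case=> n [a0 Fa]; exists n; split=> [i /a0 /= ->|s /=]; first by rewrite linear0.
by rewrite Fa vpoly_linear.
Qed.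

Lemma has_coefs_scale (F : k -> V) a c : has_coefs F a ->
  has_coefs (fun s => F (c * s)) (fun i => c ^+ i *: a i).
Proof.
case=> n [a0 Fa]; exists n; split=> [i /a0 ->|s]; first by rewrite scaler0.
rewrite Fa; apply: eq_bigr => i _.
by rewrite scalerA exprMn mulrC.
Qed.

Lemma has_coefs_lin (u w : V) :
  has_coefs (fun s => u + s *: w) (nth 0 [:: u; w]).
Proof.
exists 2; split=> [[|[|i]] //= _|s]; first by rewrite nth_nil.
by rewrite /vpoly !big_ord_recl big_ord0 /= expr0 expr1 scale1r addr0.
Qed.
End VectorSpace.

(** The Cauchy product of an operator polynomial and a vector polynomial. *)
Lemma has_coefs_apply (U V : vectType k) (F : k -> 'Hom(U, V)) A (g : k -> U) a :
  has_coefs F A -> has_coefs g a ->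
  has_coefs (fun s => F s (g s)) (fun l => \sum_(i < l.+1) A i (a (l - i)%N)).
Proof.
case=> n [A0 FA] [m [a0 ga]]; exists (n + m)%N; split=> [l ln|s].
  rewrite big1 // => i _; case: (leqP n i) => [/A0 ->|lt_i]; first by rewrite lfunE.
  by rewrite a0 ?linear0 //; lia.
rewrite FA ga /vpoly sum_lfunE.
transitivity (\sum_(i < n + m) \sum_(l < n + m | (i <= l)%N)
    s ^+ l *: A i (a (l - i)%N)); last first.
  rewrite (exchange_big_dep xpredT) //=; apply: eq_bigr => l _.
  rewrite scaler_sumr (big_ord_widen (n + m) (fun i => s ^+ l *: A i (a (l - i)%N))) //=.
rewrite (big_ord_widen (n + m) (fun i => (s ^+ i *: A i) (vpoly m a s))) ?leq_addr //.
rewrite big_mkcond; apply: eq_bigr => i _.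
case: ltnP => [lt_i|/A0 Ai0]; last first.
  by rewrite big1 // => l _; rewrite Ai0 lfunE scaler0.
rewrite scale_lfunE -(vpoly_widen (m := (n + m - i)%N) _ a0); last by lia.
rewrite linear_sum scaler_sumr.
rewrite -(big_mkord xpredT (fun j => s ^+ i *: A i (s ^+ j *: a j))).
rewrite -(big_mkord (fun l => (i <= l)%N) (fun l => s ^+ l *: A i (a (l - i)%N))).
rewrite [RHS](big_cat_nat _ (n := i)) //=; last exact: ltnW.
rewrite [X in _ = X + _]big1_seq ?add0r; last first.
  by move=> l /andP[le_i]; rewrite mem_index_iota => /andP[_]; lia.
rewrite -[in RHS](add0n (i : nat)) big_addn !add0n [RHS]big_mkcond /=.
apply: eq_bigr => l _; rewrite leq_addl addnK linearZ scalerA /= -exprD addnC.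
by [].
Qed.

Lemma has_coefs_at (U V : vectType k) (F : k -> 'Hom(U, V)) A u :
  has_coefs F A -> has_coefs (fun s => F s u) (fun i => A i u).
Proof.
case=> n [A0 FA]; exists n; split=> [i /A0 ->|s]; first by rewrite lfunE.
by rewrite FA /vpoly sum_lfunE; apply: eq_bigr => i _; rewrite scale_lfunE.
Qed.

Section OneParameter.
Variable V : vectType k.
Implicit Types (F : k -> 'End(V)) (A : nat -> 'End(V)).

Lemma has_coefs_shift n (a : nat -> V) t :
  has_coefs (fun s => vpoly n a (t + s))
    (fun i => \sum_(l < n) (t ^+ (l - i) *+ 'C(l, i)) *: a l).
Proof.
exists n; split=> [i ni|s].
  by rewrite big1 // => l _; rewrite bin_small ?mulr0n ?scale0r //; apply: leq_trans ni.
rewrite /vpoly; under [RHS]eq_bigr do rewrite scaler_sumr.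
rewrite exchange_big; apply: eq_bigr => l _; rewrite exprDn scaler_suml.
rewrite (big_ord_widen n (fun i => (t ^+ (l - i) * s ^+ i *+ 'C(l, i)) *: a l)) //.
rewrite big_mkcond; apply: eq_bigr => i _; rewrite scalerA mulrnAr mulrC.
by case: ltnP => // lt_i; rewrite bin_small // mulr0n scale0r.
Qed.

(** This says that [F] is the exponential of its linear coefficient, with denominators cleared. *)
Lemma one_parameter_coefs F A : has_coefs F A ->
  (forall s t, F (s + t) = (F s \o F t)%VF) ->
  forall j u, A 1%N (A j u) = A j.+1 u *+ j.+1.
Proof.
move=> FA FM j u; have [n [A0 FE]] := FA.
have A0u i : (n <= i)%N -> A i u = 0 by move/A0 ->; rewrite lfunE.
have FuE s : F s u = vpoly n (A^~ u) s.
  by rewrite FE sum_lfunE; apply: eq_bigr => i _; rewrite scale_lfunE.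
(* The coefficient of [s] in F(s + t) u, computed by the group law on the left and as a derivative
   at [t] on the right. *)
have hA t : A 1%N (F t u) = vpoly n (fun l => A l.+1 u *+ l.+1) t.
  have := has_coefs_inj (has_coefs_at (F t u) FA) (has_coefs_shift n (A^~ u) t).
  move=> /(_ _ 1%N) -> => [|s _]; last by rewrite -FuE addrC FM lfunE.
  rewrite -(vpoly_widen (m := n.+1) (n := n)) => [|i ni|//]; last first.
    by rewrite A0u ?mul0rn //; apply: leqW.
  case: {FE} n A0 A0u {FuE} => [|n] A0 A0u.
    by rewrite big_ord0 /vpoly big_ord_recl big_ord0 A0u ?mul0rn ?scaler0 ?addr0.
  rewrite big_ord_recl bin_small // mulr0n scale0r add0r.
  rewrite -[RHS]/(vpoly n.+2 _ t) (vpoly_widen (n := n)) => [|i ni|]; last 2 first.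
  - by rewrite A0u ?mul0rn.
  - by rewrite leqW.
  by apply: eq_bigr => i _; rewrite bin1 subSS subn0 -scalerMnl scalerMnr.
have hR : has_coefs (fun t => A 1%N (F t u)) (fun l => A l.+1 u *+ l.+1).
  by exists n; split=> // i ni; rewrite A0u ?mul0rn //; apply: leqW.
by have /has_coefs_inj/(_ hR)/(_ (fun _ _ => erefl) j) :=
  has_coefs_linear (A 1%N) (has_coefs_at u FA).
Qed.

(** The bilinear part in [s] and [t] of the commutator formula is the Lie bracket. It is extracted
    one variable at a time: the coefficient of [s] for fixed [t], then that of [t]. *)
Lemma commutator_coefs F F' F'' A B C c : has_coefs F A -> has_coefs F' B ->
  has_coefs F'' C -> F 0 = \1%VF -> F' 0 = \1%VF -> F'' 0 = \1%VF ->
  (forall s t u, F s (F' t u) = F' t (F s (F'' (c * s * t) u))) ->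
  forall u, A 1%N (B 1%N u) = B 1%N (A 1%N u) + c *: C 1%N u.
Proof.
move=> FA FB FC F0 F'0 F''0 comm u.
have A1 w : A 0%N w = w by rewrite (has_coefs0 FA) F0 lfunE.
have B1 w : B 0%N w = w by rewrite (has_coefs0 FB) F'0 lfunE.
have C1 w : C 0%N w = w by rewrite (has_coefs0 FC) F''0 lfunE.
have eA t : A 1%N (F' t u) = F' t (A 1%N u + t *: (c *: C 1%N u)).
  have hL := has_coefs_at (F' t u) FA.
  have := has_coefs_apply FA (has_coefs_scale (c * t) (has_coefs_at u FC)).
  move/(has_coefs_linear (F' t)) => hR.
  rewrite (has_coefs_inj hL hR) => [|s _] /=; last by rewrite comm mulrAC.
  by rewrite !big_ord_recl big_ord0 /= A1 expr0 expr1 scale1r C1 addr0 addrC scalerA (mulrC c).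
have hL := has_coefs_linear (A 1%N) (has_coefs_at u FB).
have := has_coefs_apply FB (has_coefs_lin (A 1%N u) (c *: C 1%N u)).
move/(has_coefs_inj hL) => /(_ _ 1%N) /= -> => [|s _]; last exact: eA.
by rewrite !big_ord_recl big_ord0 /= B1 addr0 addrC.
Qed.

Lemma commute_coefs F F' A B : has_coefs F A -> has_coefs F' B ->
  F 0 = \1%VF -> F' 0 = \1%VF ->
  (forall s t u, F s (F' t u) = F' t (F s u)) ->
  forall u, A 1%N (B 1%N u) = B 1%N (A 1%N u).
Proof.
move=> FA FB F0 F'0 comm u.
have FC : has_coefs (fun=> \1%VF) (nth 0 [:: \1%VF : 'End(V)]).
  exists 1; split=> [[|i] // _|s]; first by rewrite /= nth_nil.
  by rewrite /vpoly big_ord_recl big_ord0 expr0 scale1r addr0.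
rewrite (@commutator_coefs F F' _ A B _ 0 FA FB FC) ?scale0r ?addr0 // => s t w.
by rewrite lfunE.
Qed.
End OneParameter.
End Coefficients.

(** * The Lie algebra relations satisfied by the simple root vectors *)

Definition adjacent (i j : 'I_4) := (i != j) && ((i == a2) || (j == a2)).

Lemma adjacent_root i j : adjacent i j -> is_root (- simple i - simple j).
Proof.
by move: i j; do 2!apply: I4P; rewrite // is_rootE !mxE /= ?eqxx.
Qed.

Lemma adjacent_pos i j : adjacent i j -> positive (simple i + simple j).
Proof.
by move: i j; do 2!apply: I4P; rewrite // positiveE is_rootE !mxE /= ?eqxx.
Qed.

Lemma not_root_simple i j : i != j -> simple i - simple j != 0 /\
  ~~ is_root (simple i - simple j).
Proof.
move=> ij; split; last first.
  by move: i j ij; do 2!apply: I4P; rewrite // is_rootE !mxE /= ?eqxx.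
apply/eqP => /rowP/(_ i)/eqP; rewrite !mxE !eqxx (negPf ij) /=.
by rewrite subr0 oner_eq0.
Qed.

Lemma not_adjacent_root i j : ~~ adjacent i j -> i != j ->
  - simple i - simple j != 0 /\ ~~ is_root (- simple i - simple j).
Proof.
move=> aij ij; split; last first.
  by move: i j ij aij; do 2!apply: I4P; rewrite // is_rootE !mxE /= ?eqxx.
apply/eqP => /rowP/(_ i)/eqP; rewrite !mxE !eqxx /= (negPf ij).
by rewrite subr0 oppr_eq0 oner_eq0.
Qed.

Lemma adjacent_string i j : adjacent i j ->
  [/\ - simple i + (- simple i - simple j) != 0,
     ~~ is_root (- simple i + (- simple i - simple j)),
     simple i + (- simple i - simple j) = - simple j &
     - simple j + simple i != 0].
Proof.
move=> aij; have /andP[ij _] := aij; split.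
- apply/eqP => /rowP/(_ i)/eqP; rewrite !mxE !eqxx (negPf ij) /=.
  by rewrite subr0 -opprD oppr_eq0.
- by move: i j {ij} aij; do 2!apply: I4P; rewrite // is_rootE !mxE /= ?eqxx.
- by rewrite addrA subrr add0r.
- apply/eqP => /rowP/(_ i)/eqP; rewrite !mxE !eqxx (negPf ij) /=.
  by rewrite oppr0 add0r oner_eq0.
Qed.

(** The sign that makes [X_i, [Y_i, Y_j]] equal to Y_j rather than its opposite, in agreement with
    the Cartan integer -1. *)
Lemma struct_const_adjacent (k : fieldType) i j : adjacent i j ->
  struct_const k (- simple i) (- simple j) *
  struct_const k (simple i) (- simple i - simple j) = 1.
Proof.
move=> aij; have [_ _ e _] := adjacent_string aij.
have sN r : positive r -> sgn_root k (- r) = -1.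
  by move=> /positive_opp/negPf pr; rewrite /sgn_root pr.
have sP r : positive r -> sgn_root k r = 1 by rewrite /sgn_root => ->.
rewrite /struct_const e -opprD !sN ?sP ?positive_simple ?adjacent_pos //.
have -> : eps_exponent (- simple i) (- simple j) = eps_exponent (simple i) (simple j).
  by rewrite /eps_exponent !sum_I4 !mxE; ring.
have -> : eps_exponent (simple i) (- (simple i + simple j)) =
    - 1 - eps_exponent (simple i) (simple j).
  rewrite /eps_exponent !sum_I4 !mxE; move: i {aij e} j.
  by apply: I4P => j /=; ring.
set m := eps_exponent _ _.
have m1 : (-1 : k) != 0 by rewrite oppr_eq0 oner_eq0.
have AB : (-1 : k) ^ m * (-1) ^ (- 1 - m) = -1.
  by rewrite -expfzDr // addrCA subrr addr0 exprN1 invrN1.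
move: AB; move: (_ ^ m) (_ ^ (- 1 - m)) => A B AB.
by transitivity (- (A * B)); [ring | rewrite AB opprK].
Qed.

Section Generators.
Variables (k : fieldType) (char_k : [pchar k] =i pred0).
Variables (G : groupType) (x : rootlat -> k -> G) (xrel : steinberg_relations x).
Variables (V : vectType k) (rho : G -> 'End(V)) (rho_repr : representation rho).

Lemma repr_one u : rho 1%g u = u.
Proof. by rewrite (proj1 rho_repr) lfunE. Qed.

Lemma repr_mul g h u : rho (g * h)%g u = rho g (rho h u).
Proof. by rewrite (proj2 rho_repr) lfunE. Qed.

Lemma repr_invK g : cancel (rho g) (rho g^-1%g).
Proof. by move=> u; rewrite -repr_mul mulVg repr_one. Qed.

Lemma repr_Kinv g : cancel (rho g^-1%g) (rho g).
Proof. by move=> u; rewrite -repr_mul mulgV repr_one. Qed.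

(** [X] is the derivative at 0 of the one-parameter group of [r], that is the action of a root
    vector. *)
Definition generator (r : rootlat) (X : 'End(V)) :=
  exists2 A, has_coefs (fun s => rho (x r s)) A & A 1%N = X.

Lemma generator_exists r : rational x rho -> is_root r -> exists X, generator r X.
Proof.
move=> rat /rat[n [A hA]]; pose B i := if (i < n)%N then A i else 0.
exists (B 1%N); exists B => //; exists n; split=> [i|s].
  by rewrite /B leqNgt => /negPf ->.
by rewrite hA; apply: eq_bigr => i _; rewrite /B ltn_ord.
Qed.

Let rho0 r : is_root r -> rho (x r 0) = \1%VF.
Proof. by move=> rr; rewrite (root_elt0 xrel) // (proj1 rho_repr). Qed.

Lemma generator_comm r r' X X' X'' : is_root r -> is_root r' -> is_root (r + r') ->
  generator r X -> generator r' X' -> generator (r + r') X'' ->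
  forall u, X (X' u) = X' (X u) + struct_const k r r' *: X'' u.
Proof.
move=> rr rr' rrr' [A hA <-] [B hB <-] [C hC <-].
apply: (commutator_coefs char_k hA hB hC); rewrite ?rho0 // => s t u.
by rewrite -!repr_mul commgC (steinberg_comm xrel) // mulgA.
Qed.

Lemma generator_commute r r' X X' : is_root r -> is_root r' -> r + r' != 0 ->
  ~~ is_root (r + r') -> generator r X -> generator r' X' ->
  forall u, X (X' u) = X' (X u).
Proof.
move=> rr rr' n0 nr [A hA <-] [B hB <-].
apply: (commute_coefs char_k hA hB); rewrite ?rho0 // => s t u.
by rewrite -!repr_mul (steinberg_commute xrel).
Qed.

Lemma generator_coefs r X : is_root r -> generator r X ->
  exists A, [/\ has_coefs (fun s => rho (x r s)) A, A 1%N = X,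
    forall u, A 0%N u = u & forall j u, X (A j u) = A j.+1 u *+ j.+1].
Proof.
move=> rr [A hA <-]; exists A; split=> // [u|].
  by rewrite (has_coefs0 hA) rho0 // lfunE.
apply: (one_parameter_coefs char_k hA) => s t.
by rewrite (steinberg_add xrel) // (proj2 rho_repr).
Qed.

(** [serre_YYY] is ad(Y_i)^2 Y_j = 0, and [serre_HY] is [H_i, Y_j] = Y_j with H_i = [X_i, Y_i]
    written out, since H_i is not a generator of any root subgroup. *)
Record serre_relations (X Y : 'I_4 -> 'End(V)) : Prop := {
  serre_XY : forall i j u, i != j -> X i (Y j u) = Y j (X i u);
  serre_YY : forall i j u, ~~ adjacent i j -> Y i (Y j u) = Y j (Y i u);
  serre_YYY : forall i j u, adjacent i j ->
    Y i (Y i (Y j u)) + Y j (Y i (Y i u)) = Y i (Y j (Y i u)) *+ 2;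
  serre_HY : forall i j u, adjacent i j ->
    X i (Y i (Y j u)) - Y i (X i (Y j u)) =
    Y j (X i (Y i u) - Y i (X i u)) + Y j u
}.

Lemma generators_serre X Y : rational x rho ->
  (forall i, generator (simple i) (X i)) ->
  (forall i, generator (- simple i) (Y i)) -> serre_relations X Y.
Proof.
move=> rat gX gY; have rN i : is_root (- simple i) by rewrite is_rootN is_root_simple.
have XY i j u : i != j -> X i (Y j u) = Y j (X i u).
  by move/not_root_simple => [n0 nr]; apply: generator_commute n0 nr _ _ u; rewrite ?is_root_simple.
(* [Z] is the root vector of -(a_i + a_j), so [Y_i, Y_j] is a sign times [Z]; it is eliminated from
   the final relations. *)
have adj i j : adjacent i j -> exists Z, [/\ forall u, Y i (Z u) = Z (Y i u),
    forall u, Y i (Y j u) = Y j (Y i u) + struct_const k (- simple i) (- simple j) *: Z u &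
    forall u, X i (Z u) = Z (X i u) + struct_const k (simple i) (- simple i - simple j) *: Y j u].
  move=> aij; have [n0 nr e m0] := adjacent_string aij; have rZ := adjacent_root aij.
  have [Z gZ] := generator_exists rat rZ; exists Z; split=> u.
  - exact: generator_commute n0 nr _ _ u.
  - exact: generator_comm gZ u.
  - by apply: generator_comm; rewrite ?e ?is_root_simple.
split=> // i j u.
- move=> nadj; have [->//|ij] := eqVneq i j.
  by have [n0 nr] := not_adjacent_root nadj ij; apply: generator_commute n0 nr _ _ u.
- case/adj => Z [YZ YY _]; have := YZ u.
  set c := struct_const _ _ _ in YY.
  have cZ w : c *: Z w = Y i (Y j w) - Y j (Y i w) by rewrite YY addrC addKr.
  move/(congr1 ( *:%R c)); rewrite -linearZ /= !cZ linearB /= => /eqP.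
  by rewrite subr_eq addrAC eq_sym subr_eq mulr2n eq_sym => /eqP.
- move=> aij; have [Z [YZ YY XZ]] := adj _ _ aij.
  have ij : i != j by case/andP: aij.
  rewrite YY XY // YY [X i (_ + _)]linearD linearZ /= XZ XY // linearB /=.
  rewrite scalerDr scalerA struct_const_adjacent // scale1r opprD !addrA.
  by rewrite [LHS](ACl (1*4*3*2*5))%AC /= addrK.
Qed.
End Generators.

(** * The weight basis *)

(* The weights of the 8-dimensional representation are numbered 0, ..., 7;
   adding a_i to the weight number a, or subtracting it, gives the weight
   number [raising i a], resp. [lowering i a], where 8 means: not a weight. *)
Definition lowering (i : 'I_4) (a : nat) : nat :=
  (nth 8 (nth [::] [:: [:: 1; 8; 8; 8; 8; 8; 7; 8];
                      [:: 8; 2; 8; 8; 8; 6; 8; 8];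
                      [:: 8; 8; 3; 8; 5; 8; 8; 8];
                      [:: 8; 8; 4; 5; 8; 8; 8; 8]] i) a)%N.

Definition raising (i : 'I_4) (a : nat) : nat :=
  (nth 8 (nth [::] [:: [:: 8; 0; 8; 8; 8; 8; 8; 6];
                      [:: 8; 8; 1; 8; 8; 8; 5; 8];
                      [:: 8; 8; 8; 2; 8; 4; 8; 8];
                      [:: 8; 8; 8; 8; 2; 3; 8; 8]] i) a)%N.

Lemma raising_default i a : (8 <= a)%N -> raising i a = 8%N.
Proof. by move=> le; rewrite /raising; move: i; apply: I4P; apply: nth_default. Qed.

Lemma lowering_default i a : (8 <= a)%N -> lowering i a = 8%N.
Proof. by move=> le; rewrite /lowering; move: i; apply: I4P; apply: nth_default. Qed.

(** * The action of the simple root vectors on the highest weight vector *)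

Section HighestWeight.
Variables (k : fieldType) (char_k : [pchar k] =i pred0).

Lemma has_coefs_inv (V : vectType k) (F F' : k -> V) a b m :
  has_coefs F a -> has_coefs F' b ->
  (forall s, s != 0 -> s ^+ m *: F' s^-1 = F s) ->
  forall j, b j = if (j <= m)%N then a (m - j)%N else 0.
Proof.
case=> n [a0 Fa] [n' [b0 Fb]] e.
apply: (@vpoly_inv _ char_k _ (maxn n n')) => [i|i|s s0].
- by rewrite geq_max => /andP[/a0].
- by rewrite geq_max => /andP[_ /b0].
by rewrite (vpoly_widen _ a0) ?leq_maxl // (vpoly_widen _ b0) ?leq_maxr // -Fa -Fb e.
Qed.

Variables (G : groupType) (x : rootlat -> k -> G) (xrel : steinberg_relations x).
Variables (V : vectType k) (rho : G -> 'End(V)) (rho_repr : representation rho).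
Variables (X Y : 'I_4 -> 'End(V)).
Hypothesis gX : forall i, generator x rho (simple i) (X i).
Hypothesis gY : forall i, generator x rho (- simple i) (Y i).
Variables (v : V) (m : 'I_4 -> nat).
Hypothesis v_highest : highest_weight_vector x rho m v.

Lemma highest_X i : X i v = 0.
Proof.
case: (gX i) => A hA <-; case: v_highest => _ hv _.
have := has_coefs_inj char_k (has_coefs_at v hA) (has_coefs_lin v 0).
by move=> /(_ _ 1%N) ->// s _; rewrite scaler0 addr0 hv ?positive_simple.
Qed.

(** Only the rank one group of a_i is involved. By [vpoly_inv] the polynomial x_(-i)(s) v has degree
    at most [m i], and its coefficients are those of x_i(s) u, for a suitable [u], in reverse order.
    For weight 1 this gives Y_i v = u and X_i u = v. *)
Lemma highest_Y i : [/\ (m i = 0%N) -> Y i v = 0,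
  (m i = 1%N) -> Y i (Y i v) = 0 & (m i = 1%N) -> X i (Y i v) = v].
Proof.
have rN : is_root (- simple i) by rewrite is_rootN is_root_simple.
have [A [hA A1 A0 _]] := generator_coefs char_k xrel rho_repr (is_root_simple i) (gX i).
have [B [hB B1 B0 BS]] := generator_coefs char_k xrel rho_repr rN (gY i).
case: v_highest => _ hv wt.
pose u := rho (w_elt x (simple i) 1)^-1%g v.
(* As h(s) = w(s) w(1)^-1 multiplies [v] by s^m, the vector w(s)^-1 s^m v is [u] for every [s].
   Writing w(s)^-1 as a product of three root elements, the rightmost of which fixes [v], yields the
   identity. *)
have e s : s != 0 -> s ^+ m i *: rho (x (- simple i) s^-1) v = rho (x (simple i) s) u.
  move=> s0; have := wt i s s0; rewrite /h_elt repr_mul // -/u => wv.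
  have : rho (w_elt x (simple i) s)^-1%g (s ^+ m i *: v) = u.
    by rewrite -wv repr_invK.
  move=> <-; rewrite !linearZ /= -repr_mul // /w_elt !invgM.
  rewrite (root_eltN xrel _ rN) invgK -(root_eltN xrel _ (is_root_simple i)).
  rewrite !mulgA -(steinberg_add xrel) ?is_root_simple // subrr.
  rewrite (root_elt0 xrel) ?is_root_simple // mul1g repr_mul //.
  by rewrite (hv (simple i)) ?positive_simple.
have := has_coefs_inv (has_coefs_at u hA) (has_coefs_at v hB) e => bE.
split=> mi; rewrite ?mi in bE.
- by rewrite -B1 bE.
- by have := BS 1%N v; rewrite (bE 2) mul0rn B1.
- by have := bE 0%N; have := bE 1%N; rewrite /= subnn A0 subn0 B0 B1 A1 => -> <-.
Qed.
End HighestWeight.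

(** * The eight weight vectors and the tables of the X_i and Y_i *)

Section WeightBasis.
Variables (k : fieldType) (char_k : [pchar k] =i pred0) (V : vectType k).
Variables (X Y : 'I_4 -> 'End(V)) (XYserre : serre_relations X Y) (v : V).
Hypotheses (Xv : forall i, X i v = 0) (Yv : forall i, i != a1 -> Y i v = 0).
Hypotheses (YYv : Y a1 (Y a1 v) = 0) (XYv : X a1 (Y a1 v) = v).

Let e1 := Y a1 v.
Let e2 := Y a2 e1.
Let e3 := Y a3 e2.
Let e4 := Y a4 e2.
Let e5 := Y a4 e3.
Let e6 := Y a2 e5.
Let e7 := Y a1 e6.

Definition weight_vectors : seq V := [:: v; e1; e2; e3; e4; e5; e6; e7].

Let YY i j u : ~~ adjacent i j -> Y i (Y j u) = Y j (Y i u).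
Proof. exact: (serre_YY XYserre). Qed.

Let XY i j u : i != j -> X i (Y j u) = Y j (X i u).
Proof. exact: (serre_XY XYserre). Qed.

Let YYY i j u : adjacent i j -> Y i u = 0 -> Y i (Y i (Y j u)) = 0.
Proof.
move=> aij Yu; have := serre_YYY XYserre u aij.
by rewrite Yu !linear0 mul0rn addr0.
Qed.

(** The Serre relation leaves only its middle term, whose coefficient 2 is invertible. *)
Let YYY' i j u : adjacent i j -> Y j u = 0 -> Y i (Y i u) = 0 -> Y i (Y j (Y i u)) = 0.
Proof.
move=> aij Yu YYu; have := serre_YYY XYserre u aij.
rewrite Yu YYu !linear0 addr0 => /esym/eqP; rewrite -scaler_nat scaler_eq0.
by rewrite (natr_eq0_char0 char_k) => /eqP.
Qed.

(** Here [X_i, Y_i] kills [u], so it acts on Y_j u by the scalar 1. *)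
Let XYY i j u : adjacent i j -> Y i u = 0 -> X i u = 0 -> X i (Y j u) = 0 ->
  X i (Y i (Y j u)) = Y j u.
Proof.
move=> aij Yu Xu XYu; have := serre_HY XYserre u aij.
by rewrite Yu Xu XYu !linear0 !addr0 linear0 add0r.
Qed.

Let Y_weight : forall i a, (a < 8)%N ->
  Y i weight_vectors`_a = weight_vectors`_(lowering i a).
Proof.
have Y_0 i : i != a1 -> Y i v = 0 by exact: Yv.
have Y_1 i : i != a2 -> Y i e1 = 0.
  by move: i; apply: I4P => // _; rewrite /e1 YY // Y_0 // linear0.
have Y_2 i : (i == a1) || (i == a2) -> Y i e2 = 0.
  by move: i; apply: I4P => // _; [apply: YYY'; rewrite // Y_0 | apply: YYY; rewrite // Y_0].
have Y_3 i : i != a4 -> Y i e3 = 0.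
  move: i; apply: I4P => // _; first by rewrite /e3 YY // Y_2 // linear0.
    by apply: YYY' => //; [exact: Y_1 | exact: Y_2].
  by apply: YYY; rewrite // Y_1.
have Y_4 i : i != a3 -> Y i e4 = 0.
  move: i; apply: I4P => // _; first by rewrite /e4 YY // Y_2 // linear0.
    by apply: YYY' => //; [exact: Y_1 | exact: Y_2].
  by apply: YYY; rewrite // Y_1.
(* [e5] is reached from [e2] through the two commuting leaves a3 and a4 in either order; both
   expressions are needed, according to which leaf acts next. *)
have Y34 : Y a3 e4 = e5 by rewrite /e4 YY.
have Y_5 i : i != a2 -> Y i e5 = 0.
  move: i; apply: I4P => // _; first by rewrite /e5 YY // Y_3 // linear0.
    by rewrite /e5 YY // Y_3 // linear0.
  by rewrite -Y34 YY // Y_4 // linear0.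
have Y_6 i : i != a1 -> Y i e6 = 0.
  move: i; apply: I4P => // _; first by apply: YYY; rewrite // Y_3.
    by rewrite /e6 -Y34; apply: YYY' => //; [exact: Y_4 | rewrite Y34; exact: Y_5].
  by apply: YYY' => //; [exact: Y_3 | exact: Y_5].
have Y_7 i : Y i e7 = 0.
  move: i; apply: I4P.
  - by apply: YYY; rewrite // Y_5.
  - by apply: YYY' => //; [exact: Y_5 | exact: Y_6].
  - by rewrite /e7 YY // Y_6 // linear0.
  - by rewrite /e7 YY // Y_6 // linear0.
by apply: I4P; case=> [|[|[|[|[|[|[|[|a]]]]]]]] //= _; rewrite ?(Y_0, Y_1, Y_2, Y_3, Y_4, Y_5, Y_6, Y_7).
Qed.

(** Each vector is Y_j of its predecessor: X_i passes through Y_j if j is not i. For j = i the value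
    is given by [XYY], except at [e1], where it is the hypothesis [XYv], and at [e5], which is
    rewritten through the other leaf. *)
Let X_weight : forall i a, (a < 8)%N ->
  X i weight_vectors`_a = weight_vectors`_(raising i a).
Proof.
have X_1 i : X i e1 = if i == a1 then v else 0.
  by case: eqP => [->//|/eqP ne]; rewrite XY // Xv linear0.
have X_2 i : X i e2 = if i == a2 then e1 else 0.
  case: eqP => [->|/eqP ne].
    by apply: XYY => //; first [exact: Yv | exact: X_1].
  by rewrite XY // X_1; case: ifP => _; rewrite ?Yv ?linear0.
have X_3 i : X i e3 = if i == a3 then e2 else 0.
  case: eqP => [->|/eqP ne].
    by apply: XYY => //; first [exact: (Y_weight a3 (a := 1)) | exact: X_1 | exact: X_2].
  rewrite XY // X_2; case: ifP => _; rewrite ?linear0 //.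
  exact: (Y_weight a3 (a := 1)).
have X_4 i : X i e4 = if i == a4 then e2 else 0.
  case: eqP => [->|/eqP ne].
    by apply: XYY => //; first [exact: (Y_weight a4 (a := 1)) | exact: X_1 | exact: X_2].
  rewrite XY // X_2; case: ifP => _; rewrite ?linear0 //.
  exact: (Y_weight a4 (a := 1)).
have Y34 : Y a3 e4 = e5 by rewrite /e4 YY.
have X_5 i : X i e5 = if i == a4 then e3 else if i == a3 then e4 else 0.
  case: eqP => [->|/eqP ne]; first by rewrite -Y34 XY // X_4.
  by rewrite XY // X_3; case: ifP => _; rewrite ?linear0.
have X_6 i : X i e6 = if i == a2 then e5 else 0.
  case: eqP => [->|/eqP ne].
    by apply: XYY => //; first [exact: (Y_weight a2 (a := 3)) | exact: X_3 | exact: X_5].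
  rewrite XY // X_5; case: ifP => _; first exact: (Y_weight a2 (a := 3)).
  by case: ifP => _; rewrite ?linear0 //; exact: (Y_weight a2 (a := 4)).
have X_7 i : X i e7 = if i == a1 then e6 else 0.
  case: eqP => [->|/eqP ne].
    by apply: XYY => //; first [exact: (Y_weight a1 (a := 5)) | exact: X_5 | exact: X_6].
  by rewrite XY // X_6; case: ifP => _; rewrite ?linear0 //; exact: (Y_weight a1 (a := 5)).
by apply: I4P; case=> [|[|[|[|[|[|[|[|a]]]]]]]] //= _; rewrite ?(Xv, X_1, X_2, X_3, X_4, X_5, X_6, X_7).
Qed.

Lemma weight_actions : forall i a,
  X i weight_vectors`_a = weight_vectors`_(raising i a) /\
  Y i weight_vectors`_a = weight_vectors`_(lowering i a).
Proof.
move=> i a; case: (ltnP a 8) => [lt_a|le_a]; first by split; [apply: X_weight|apply: Y_weight].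
rewrite raising_default // lowering_default //.
by rewrite !nth_default ?linear0.
Qed.
End WeightBasis.

Lemma raising_raising i a : raising i (raising i a) = 8%N.
Proof.
case: (ltnP a 8) => [|/raising_default ->]; last exact: raising_default.
by move: i a; apply: I4P; do 8!case=> //.
Qed.

Lemma lowering_lowering i a : lowering i (lowering i a) = 8%N.
Proof.
case: (ltnP a 8) => [|/lowering_default ->]; last exact: lowering_default.
by move: i a; apply: I4P; do 8!case=> //.
Qed.

(* The simple root vectors act by [X i] and [Y i]; these have square 0, whence
   exp (s X i) = 1 + s X i. *)
Record weight_model (k : fieldType) (G : groupType) (x : rootlat -> k -> G)
    (V : vectType k) (rho : G -> 'End(V)) (e : 8.-tuple V)
    (X Y : 'I_4 -> 'End(V)) : Prop := {
  model_basis : basis_of fullv e;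
  model_X : forall i a, X i e`_a = e`_(raising i a);
  model_Y : forall i a, Y i e`_a = e`_(lowering i a);
  model_pos : forall i s u, rho (x (simple i) s) u = u + s *: X i u;
  model_neg : forall i s u, rho (x (- simple i) s) u = u + s *: Y i u
}.

Section Model.
Variables (k : fieldType) (char_k : [pchar k] =i pred0).
Variables (G : groupType) (x : rootlat -> k -> G) (xrel : steinberg_relations x).
Variables (V : vectType k) (rho : G -> 'End(V)) (rho_repr : representation rho).

(** The exponential recursion makes all coefficients vanish from the second on. *)
Lemma generator_square0 r X u s : is_root r -> generator x rho r X ->
  X (X u) = 0 -> rho (x r s) u = u + s *: X u.
Proof.
move=> rr gX XXu.
have [A [hA A1 A0 AS]] := generator_coefs char_k xrel rho_repr rr gX.
have A2 n : A n.+2 u = 0.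
  elim: n => [|n IH]; last first.
    have /eqP := AS n.+2 u; rewrite IH linear0 eq_sym -scaler_nat scaler_eq0.
    by rewrite (natr_eq0_char0 char_k) => /eqP.
  have /eqP := AS 1%N u; rewrite A1 XXu eq_sym -scaler_nat scaler_eq0.
  by rewrite (natr_eq0_char0 char_k) => /eqP.
have [n [An0 ->]] := has_coefs_at u hA.
rewrite -(vpoly_widen (m := maxn 2 n) _ An0) ?leq_maxr //.
rewrite (vpoly_widen (n := 2)) ?leq_maxl //; last by case=> [|[|i]].
by rewrite /vpoly !big_ord_recl big_ord0 /= A0 A1 expr0 expr1 scale1r addr0.
Qed.

Lemma model_exists v : \dim {:V} = 8%N -> rational x rho -> irreducible rho ->
  (forall g, generated (root_elements x xpredT) g) ->
  highest_weight_vector x rho (fundamental_weight a1) v ->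
  exists (e : 8.-tuple V) X Y, e`_0 = v /\ weight_model x rho e X Y.
Proof.
move=> dimV rat irr xgen hv.
have rN i : is_root (- simple i) by rewrite is_rootN is_root_simple.
have /fin_all_exists[X gX] : forall i, exists X, generator x rho (simple i) X.
  by move=> i; apply: generator_exists rat (is_root_simple i).
have /fin_all_exists[Y gY] : forall i, exists Y, generator x rho (- simple i) Y.
  by move=> i; apply: generator_exists rat (rN i).
have XYserre := generators_serre char_k xrel rho_repr rat gX gY.
have Xv := highest_X char_k gX hv.
have Yv i : i != a1 -> Y i v = 0.
  move=> i1; have [h _ _] := highest_Y char_k xrel rho_repr gX gY hv i.
  by apply: h; rewrite /fundamental_weight (negPf i1).
have [_ /(_ erefl) YYv /(_ erefl) XYv] := highest_Y char_k xrel rho_repr gX gY hv a1.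
have act := weight_actions char_k XYserre Xv Yv YYv XYv.
have size_e : size (weight_vectors Y v) == 8 by [].
pose e : 8.-tuple V := Tuple size_e.
have Xe i a : X i e`_a = e`_(raising i a) by case: (act i a).
have Ye i a : Y i e`_a = e`_(lowering i a) by case: (act i a).
have pos_e i s a : rho (x (simple i) s) e`_a = e`_a + s *: X i e`_a.
  by apply: generator_square0 (gX i) _; rewrite ?is_root_simple // !Xe raising_raising.
have neg_e i s a : rho (x (- simple i) s) e`_a = e`_a + s *: Y i e`_a.
  by apply: generator_square0 (gY i) _; rewrite // !Ye lowering_lowering.
have mem_e a : e`_a \in <<e>>%VS.
  case: (ltnP a 8) => [lt_a|le_a]; first by rewrite memv_span ?mem_nth.
  by rewrite nth_default ?mem0v.
(* The inverse is included to make this a subgroup from the outset; inverses of root elements are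
   again root elements. *)
pose S g := (rho g @: <<e>> <= <<e>>)%VS /\ (rho g^-1%g @: <<e>> <= <<e>>)%VS.
have imgM g h : (rho g @: <<e>> <= <<e>>)%VS -> (rho h @: <<e>> <= <<e>>)%VS ->
    (rho (g * h)%g @: <<e>> <= <<e>>)%VS.
  move=> hg hh; rewrite (proj2 rho_repr) limg_comp.
  by apply: subv_trans hg; apply: limgS.
have S_sub : subgroup S.
  split=> [|g h [g1 g2] [h1 h2]|g [g1 g2]].
  - by rewrite /S invg1 (proj1 rho_repr) lim1g.
  - by split; rewrite ?invgM; apply: imgM.
  - by split; rewrite ?invgK.
have imgP g : (forall a, rho g e`_a \in <<e>>%VS) -> (rho g @: <<e>> <= <<e>>)%VS.
  move=> h; rewrite limg_span; apply/span_subvP => _ /mapP[u /(nthP 0)[a _ <-] ->].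
  exact: h.
have pos_S i s : (rho (x (simple i) s) @: <<e>> <= <<e>>)%VS.
  by apply: imgP => a; rewrite pos_e Xe memvD ?memvZ.
have neg_S i s : (rho (x (- simple i) s) @: <<e>> <= <<e>>)%VS.
  by apply: imgP => a; rewrite neg_e Ye memvD ?memvZ.
have SG : forall g, S g.
  apply: (generated_simple xrel xgen S_sub) => i s; split=> //.
    by rewrite -(root_eltN xrel) ?is_root_simple.
  by rewrite -(root_eltN xrel).
have v0 : v != 0 by case: hv.
have full : <<e>>%VS = fullv.
  case: irr => _ /(_ <<e>>%VS (fun g => proj1 (SG g)))[] // e0.
  by move: (mem_e 0%N); rewrite e0 memv0 (negPf v0).
have e_basis : basis_of fullv e by rewrite basisEdim full subvv size_tuple dimV.
exists e, X, Y; split=> //; split=> // i s u.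
  rewrite (coord_basis e_basis (memvf u)) !linear_sum /= -big_split /=.
  by apply: eq_bigr => j _; rewrite !linearZ /= pos_e scalerDr !scalerA mulrC.
rewrite (coord_basis e_basis (memvf u)) !linear_sum /= -big_split /=.
by apply: eq_bigr => j _; rewrite !linearZ /= neg_e scalerDr !scalerA mulrC.
Qed.
End Model.

(** * Coordinates and the invariant form *)

Lemma nat8_ind (P : nat -> Prop) : P 0%N -> P 1%N -> P 2%N -> P 3%N -> P 4%N ->
  P 5%N -> P 6%N -> P 7%N -> forall a, (a < 8)%N -> P a.
Proof. by do 8![move=> ?]; do 8![case=> //]. Qed.

Lemma raising_lowering i a b : (a < 8)%N -> (b < 8)%N ->
  (raising i b == a) = (b == lowering i a).
Proof.
by move=> lta ltb; move: a lta; apply: nat8_ind; move: b ltb; apply: nat8_ind; move: i; apply: I4P.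
Qed.

Lemma lowering_raising i a b : (a < 8)%N -> (b < 8)%N ->
  (lowering i b == a) = (b == raising i a).
Proof. by move=> lta ltb; rewrite eq_sym -raising_lowering // eq_sym. Qed.

Section Coordinates.
Variables (k : fieldType) (V : vectType k) (e : 8.-tuple V).
Hypothesis e_basis : basis_of fullv e.

(** Coordinates indexed by all natural numbers, zero from 8 on: this matches the convention e_8 = 0,
    so formulas with [raising] and [lowering] need no side condition. *)
Definition weight_coef (a : nat) (u : V) : k :=
  if insub a is Some i then coord e i u else 0.
Local Notation c := weight_coef.

Lemma weight_coefD a u w : c a (u + w) = c a u + c a w.
Proof. by rewrite /c; case: insubP => [i _ _|_]; rewrite ?linearD ?addr0. Qed.

Lemma weight_coefZ a s u : c a (s *: u) = s * c a u.
Proof. by rewrite /c; case: insubP => [i _ _|_]; rewrite ?linearZ ?mulr0. Qed.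

Lemma weight_coef0 a : c a 0 = 0.
Proof. by rewrite -(scale0r 0) weight_coefZ mul0r. Qed.

Lemma weight_coefN a u : c a (- u) = - c a u.
Proof. by rewrite -scaleN1r weight_coefZ mulN1r. Qed.

Lemma weight_coef_default a u : (8 <= a)%N -> c a u = 0.
Proof. by rewrite /c leqNgt => /negPf lt; rewrite insubF. Qed.

Lemma weight_coef_ord (i : 'I_8) u : c i u = coord e i u.
Proof. by rewrite /c valK. Qed.

Lemma weight_coef_sum u : u = \sum_(a < 8) c a u *: e`_a.
Proof.
rewrite {1}(coord_basis e_basis (memvf u)).
by apply: eq_bigr => i _; rewrite weight_coef_ord.
Qed.

Lemma weight_coef_inj u w : (forall a, (a < 8)%N -> c a u = c a w) -> u = w.
Proof.
move=> h; rewrite (weight_coef_sum u) (weight_coef_sum w).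
by apply: eq_bigr => i _; rewrite h.
Qed.

Lemma weight_coef_e a b : (a < 8)%N -> c b e`_a = (a == b)%:R.
Proof.
move=> lta; case: (ltnP b 8) => [ltb|leb]; last first.
  by rewrite weight_coef_default // (ltn_eqF (leq_trans lta leb)).
rewrite -[b]/(val (Ordinal ltb)) -[a]/(val (Ordinal lta)) weight_coef_ord.
by rewrite coord_free ?(basis_free e_basis) // eq_sym.
Qed.

Lemma weight_coef_sumE (I : Type) (r : seq I) (P : pred I) a (F : I -> V) :
  c a (\sum_(i <- r | P i) F i) = \sum_(i <- r | P i) c a (F i).
Proof. exact: (big_morph (c a) (weight_coefD a) (weight_coef0 a)). Qed.

Lemma weight_coef_map (f : {linear V -> V}) (r l : nat -> nat) :
  (forall a b, (a < 8)%N -> (b < 8)%N -> (r b == a) = (b == l a)) ->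
  (forall a, (8 <= a)%N -> (8 <= l a)%N) ->
  (forall a, f e`_a = e`_(r a)) -> forall a u, c a (f u) = c (l a) u.
Proof.
move=> rl l8 fe a u; case: (ltnP a 8) => [lta|lea]; last first.
  by rewrite !weight_coef_default ?l8.
rewrite {1}(weight_coef_sum u) linear_sum weight_coef_sumE.
under eq_bigr => b _.
  rewrite linearZ /= fe weight_coefZ.
  have -> : c a e`_(r b) = (b == l a :> nat)%:R.
    rewrite -rl //; case: (ltnP (r b) 8) => [ltr|ler]; first by rewrite weight_coef_e.
    by rewrite nth_default ?size_tuple // weight_coef0 gtn_eqF // (leq_trans lta).
  over.
case: (ltnP (l a) 8) => [ltl|lel]; last first.
  rewrite weight_coef_default // big1 // => b _.
  by rewrite ltn_eqF ?mulr0 // (leq_trans _ lel).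
rewrite (bigD1 (Ordinal ltl)) //= eqxx mulr1 big1 ?addr0 // => b.
by rewrite -val_eqE /= => /negPf ->; rewrite mulr0.
Qed.

Lemma weight_vector8 : e`_8 = 0.
Proof. by rewrite nth_default ?size_tuple. Qed.
End Coordinates.

Section ModelCoordinates.
Variables (k : fieldType) (G : groupType) (x : rootlat -> k -> G).
Variables (V : vectType k) (rho : G -> 'End(V)) (e : 8.-tuple V).
Variables (X Y : 'I_4 -> 'End(V)) (mod_e : weight_model x rho e X Y).
Let e_basis := model_basis mod_e.

Lemma weight_coef_X i a u : weight_coef e a (X i u) = weight_coef e (lowering i a) u.
Proof.
apply: (weight_coef_map e_basis) => [a' b' ? ?|a' le|a'].
- exact: raising_lowering.
- by rewrite lowering_default.
- exact: model_X mod_e _ _.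
Qed.

Lemma weight_coef_Y i a u : weight_coef e a (Y i u) = weight_coef e (raising i a) u.
Proof.
apply: (weight_coef_map e_basis) => [a' b' ? ?|a' le|a'].
- exact: lowering_raising.
- by rewrite raising_default.
- exact: model_Y mod_e _ _.
Qed.
End ModelCoordinates.

(** The parity of the number of lowering steps from weight 0 to weight [a]; each step changes the
    sign by skewness. *)
Definition weight_sign (a : nat) : bool :=
  nth false [:: false; true; false; true; true; false; true; false] a.

(** Row 0 vanishes at every raised weight because the X_i kill e_0, which leaves column 7 only.
    Skewness then deduces the row of [lowering i a] from that of [a]. *)
Lemma form_table (R : pzRingType) (B : nat -> nat -> R) :
  (forall a, B a 8%N = 0) -> (forall i d, B 0%N (raising i d) = 0) ->
  (forall i a d, B (lowering i a) d = - B a (lowering i d)) ->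
  forall a, (a < 8)%N -> forall d, (d < 8)%N ->
  B a d = if (a + d == 7)%N then (-1) ^+ weight_sign a * B 0%N 7%N else 0.
Proof.
move=> b8 b0 step; have [beta betaE] : exists beta, beta = B 0%N 7%N by exists (B 0%N 7%N).
rewrite -betaE.
have w0 d : (d < 8)%N -> B 0%N d = if d == 7%N then beta else 0.
  move: d; apply: nat8_ind => //=.
  - exact: (b0 a1 1).
  - exact: (b0 a2 2).
  - exact: (b0 a3 3).
  - exact: (b0 a4 5).
  - exact: (b0 a3 5).
  - exact: (b0 a2 6).
  - exact: (b0 a1 7).
have w1 d : (d < 8)%N -> B 1%N d = if d == 6%N then - beta else 0.
  by move: d; apply: nat8_ind; rewrite (step a1 0) /lowering /= ?b8 ?w0 ?oppr0.
have w2 d : (d < 8)%N -> B 2%N d = if d == 5%N then beta else 0.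
  by move: d; apply: nat8_ind; rewrite (step a2 1) /lowering /= ?b8 ?w1 ?oppr0 ?opprK.
have w3 d : (d < 8)%N -> B 3%N d = if d == 4%N then - beta else 0.
  by move: d; apply: nat8_ind; rewrite (step a3 2) /lowering /= ?b8 ?w2 ?oppr0 ?opprK.
have w4 d : (d < 8)%N -> B 4%N d = if d == 3%N then - beta else 0.
  by move: d; apply: nat8_ind; rewrite (step a4 2) /lowering /= ?b8 ?w2 ?oppr0 ?opprK.
have w5 d : (d < 8)%N -> B 5%N d = if d == 2%N then beta else 0.
  by move: d; apply: nat8_ind; rewrite (step a4 3) /lowering /= ?b8 ?w3 ?oppr0 ?opprK.
have w6 d : (d < 8)%N -> B 6%N d = if d == 1%N then - beta else 0.
  by move: d; apply: nat8_ind; rewrite (step a2 5) /lowering /= ?b8 ?w5 ?oppr0 ?opprK.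
have w7 d : (d < 8)%N -> B 7%N d = if d == 0%N then beta else 0.
  by move: d; apply: nat8_ind; rewrite (step a1 6) /lowering /= ?b8 ?w6 ?oppr0 ?opprK.
apply: nat8_ind => d ltd; rewrite ?(w0, w1, w2, w3, w4, w5, w6, w7) //;
  by move: d ltd; apply: nat8_ind; rewrite /= ?expr0 ?expr1 ?mul1r ?mulN1r.
Qed.


Section BilinearForm.
Variables (k : fieldType) (V : vectType k) (e : 8.-tuple V).
Variables (X Y : 'I_4 -> 'End(V)).
Hypothesis e_basis : basis_of fullv e.
Hypothesis Xe : forall i a, X i e`_a = e`_(raising i a).
Hypothesis Ye : forall i a, Y i e`_a = e`_(lowering i a).
Variable b : {biscalar V}.
Hypothesis bX : forall i u w, b (X i u) w = - b u (X i w).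
Hypothesis bY : forall i u w, b (Y i u) w = - b u (Y i w).

Let c := weight_coef e.
Let e8 : e`_8 = 0 := weight_vector8 e.

Lemma form_weight a : (a < 8)%N -> forall d, (d < 8)%N ->
  b e`_a e`_d = if (a + d == 7)%N then (-1) ^+ weight_sign a * b e`_0 e`_7 else 0.
Proof.
apply: (form_table (B := fun p q => b e`_p e`_q)) => [a'|i d|i a' d].
- by rewrite e8 linear0r.
- rewrite -Xe -[b _ _]opprK -bX Xe.
  have -> : raising i 0 = 8%N by move: i; apply: I4P.
  by rewrite e8 linear0l oppr0.
- by rewrite -!Ye bY.
Qed.

Lemma form_coefs u w : b u w = b e`_0 e`_7 *
  \sum_(a < 8) (-1) ^+ weight_sign a * c a u * c (7 - a) w.
Proof.
rewrite {1}(weight_coef_sum e_basis u) linear_sumlz mulr_sumr.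
apply: eq_bigr => a _; rewrite linearZl_LR /= {1}(weight_coef_sum e_basis w) linear_sumr.
have lt7 : (7 - a < 8)%N by rewrite ltnS leq_subr.
rewrite (bigD1 (Ordinal lt7)) //= big1 ?addr0 => [|d nd]; last first.
  rewrite linearZr_LR /= form_weight // ifN ?mulr0 //.
  by apply: contra nd => /eqP ad; rewrite -val_eqE /=; apply/eqP; lia.
rewrite linearZr_LR /= form_weight // subnKC; last by rewrite -ltnS.
by rewrite eqxx /= /c; ring.
Qed.
End BilinearForm.

(** * The product in the weight basis *)

(* [e_a * e_d] is a fixed multiple of [e_(star_index a d)], up to the sign
   given by [star_sign], with [e_8 = 0]. *)
Definition star_index (a d : nat) : nat :=
  (nth 8 (nth [::] [:: [:: 8; 8; 8; 8; 0; 1; 2; 4];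
                      [:: 8; 8; 0; 1; 8; 8; 3; 5];
                      [:: 8; 0; 8; 2; 8; 3; 8; 6];
                      [:: 0; 8; 8; 4; 8; 5; 6; 8];
                      [:: 8; 1; 2; 8; 3; 8; 8; 7];
                      [:: 1; 8; 4; 8; 5; 8; 7; 8];
                      [:: 2; 4; 8; 8; 6; 7; 8; 8];
                      [:: 3; 5; 6; 7; 8; 8; 8; 8]] a) d)%N.

Definition star_sign (a d : nat) : bool :=
  (a, d) \in [:: (1, 2); (1, 3); (2, 3); (2, 5); (3, 0); (3, 3); (3, 5); (3, 6);
    (5, 0); (5, 6); (6, 0); (6, 1); (7, 0); (7, 1); (7, 2); (7, 3)]%N.

Lemma diagram_autE : (diagram_aut a1 = a3) * (diagram_aut a2 = a2) *
  (diagram_aut a3 = a4) * (diagram_aut a4 = a1).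
Proof. by split; [split; [split|]|]; apply: val_inj. Qed.

Lemma diagram_aut3 i : diagram_aut (diagram_aut (diagram_aut i)) = i.
Proof. by move: i; apply: I4P; apply: val_inj. Qed.

Section StarTable.
Variables (k : fieldType) (V : vectType k) (e : 8.-tuple V).
Variables (X Y : 'I_4 -> 'End(V)).
Hypothesis e_basis : basis_of fullv e.
Hypothesis Xe : forall i a, X i e`_a = e`_(raising i a).
Hypothesis Ye : forall i a, Y i e`_a = e`_(lowering i a).
Variable star : {bilinear V -> V -> V}.
Hypothesis starX : forall i u w, X (diagram_aut i) (star u w) =
  star (X i u) w + star u (X (diagram_aut (diagram_aut i)) w).
Hypothesis starY : forall i u w, Y (diagram_aut i) (star u w) =
  star (Y i u) w + star u (Y (diagram_aut (diagram_aut i)) w).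

Let c := weight_coef e.
Let e8 : e`_8 = 0 := weight_vector8 e.
Let X0 i : X i e`_0 = 0.
Proof. by rewrite Xe (_ : raising i 0 = 8%N) //; move: i; apply: I4P. Qed.

Let Y7 i : Y i e`_7 = 0.
Proof. by rewrite Ye (_ : lowering i 7 = 8%N) //; move: i; apply: I4P. Qed.

Let starXe i w : star e`_0 (X i w) = X (diagram_aut (diagram_aut i)) (star e`_0 w).
Proof. by rewrite starX X0 linear0l add0r diagram_aut3. Qed.

Let starYe i a w : star e`_(lowering i a) w =
  Y (diagram_aut i) (star e`_a w) - star e`_a (Y (diagram_aut (diagram_aut i)) w).
Proof. by rewrite starY Ye addrK. Qed.

Let coefX i a u : c a (X i u) = c (lowering i a) u.
Proof.
apply: (weight_coef_map e_basis) (Xe i) _ _ => [a' b' ? ?|a' le].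
- exact: raising_lowering.
- by rewrite lowering_default.
Qed.

Let coefY i a u : c a (Y i u) = c (raising i a) u.
Proof.
apply: (weight_coef_map e_basis) (Ye i) _ _ => [a' b' ? ?|a' le].
- exact: lowering_raising.
- by rewrite raising_default.
Qed.

(* All but two of the X i and Y i kill this product, which leaves room for a
   single weight. *)
Let star07 : star e`_0 e`_7 = c 4 (star e`_0 e`_7) *: e`_4.
Proof.
set u := star _ _.
have X0u i : i != a4 -> X i u = 0.
  move=> ni; rewrite -(diagram_aut3 i) -starXe Xe.
  have -> : raising (diagram_aut i) 7 = 8%N.
    by move: i ni; apply: I4P; rewrite ?diagram_autE.
  by rewrite e8 linear0r.
have Y0u i : i != a3 -> Y i u = 0.
  move=> ni; rewrite -(diagram_aut3 i) starY Y7 linear0r addr0 Ye.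
  have -> : lowering (diagram_aut (diagram_aut i)) 0 = 8%N.
    by move: i ni; apply: I4P; rewrite ?diagram_autE.
  by rewrite e8 linear0l.
have cX i a : i != a4 -> c (lowering i a) u = 0.
  by move=> ni; rewrite -coefX X0u //; apply: weight_coef0.
have cY i a : i != a3 -> c (raising i a) u = 0.
  by move=> ni; rewrite -coefY Y0u //; apply: weight_coef0.
apply: (weight_coef_inj e_basis) => a lta; rewrite weight_coefZ weight_coef_e //.
move: a lta; apply: nat8_ind; rewrite ?mulr0 ?mulr1 //.
- exact: (cY a1 1).
- exact: (cX a1 0).
- exact: (cX a2 1).
- exact: (cX a3 2).
- exact: (cX a3 4).
- exact: (cX a2 5).
- exact: (cX a1 6).
Qed.

Definition star_scalar : k := c 4 (star e`_0 e`_7).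
Let lam := star_scalar.
Let tab (a d : nat) := lam *: ((-1) ^+ star_sign a d *: e`_(star_index a d)).

(* The tensor product of e_0 and e_7 generates that of V with itself: the table
   follows from [star07], by applying first the X i, then the Y i. *)
Lemma star_weight a : (a < 8)%N -> forall d, (d < 8)%N -> star e`_a e`_d =
  star_scalar *: ((-1) ^+ star_sign a d *: e`_(star_index a d)).
Proof.
have s8 a' : star e`_a' e`_8 = 0 by rewrite e8 linear0r.
have up i d' : star e`_0 e`_(raising i d') =
    X (diagram_aut (diagram_aut i)) (star e`_0 e`_d') by rewrite -Xe starXe.
have XZ i s t a' : X i (s *: (t *: e`_a')) = s *: (t *: e`_(raising i a')).
  by rewrite linearZ /= linearZ /= Xe.
have YZ i s t a' : Y i (s *: (t *: e`_a')) = s *: (t *: e`_(lowering i a')).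
  by rewrite linearZ /= linearZ /= Ye.
have t07 : star e`_0 e`_7 = tab 0%N 7%N by rewrite star07 /tab /= expr0 scale1r.
have t06 : star e`_0 e`_6 = tab 0%N 6%N by rewrite (up a1 7%N) t07 /tab XZ ?diagram_autE.
have t05 : star e`_0 e`_5 = tab 0%N 5%N by rewrite (up a2 6%N) t06 /tab XZ ?diagram_autE.
have t04 : star e`_0 e`_4 = tab 0%N 4%N by rewrite (up a3 5%N) t05 /tab XZ ?diagram_autE.
have t03 : star e`_0 e`_3 = tab 0%N 3%N by rewrite (up a4 5%N) t05 /tab XZ ?diagram_autE.
have t02 : star e`_0 e`_2 = tab 0%N 2%N by rewrite (up a3 3%N) t03 /tab XZ ?diagram_autE.
have t01 : star e`_0 e`_1 = tab 0%N 1%N by rewrite (up a2 2%N) t02 /tab XZ ?diagram_autE.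
have t00 : star e`_0 e`_0 = tab 0%N 0%N by rewrite (up a1 1%N) t01 /tab XZ ?diagram_autE.
have w0 d : (d < 8)%N -> star e`_0 e`_d = tab 0%N d by move: d; apply: nat8_ind.
pose norm := (e8, expr0, expr1, scale1r, scaleN1r, scalerN, scaler0, subr0, sub0r, opprK, subrr, oppr0).
have w1 d : (d < 8)%N -> star e`_1 e`_d = tab 1%N d.
  by move: d; apply: nat8_ind; rewrite (starYe a1 0%N) Ye ?diagram_autE /lowering /= ?s8 ?w0 // /tab ?YZ /lowering /= ?norm.
have w2 d : (d < 8)%N -> star e`_2 e`_d = tab 2%N d.
  by move: d; apply: nat8_ind; rewrite (starYe a2 1%N) Ye ?diagram_autE /lowering /= ?s8 ?w1 // /tab ?YZ /lowering /= ?norm.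
have w3 d : (d < 8)%N -> star e`_3 e`_d = tab 3%N d.
  by move: d; apply: nat8_ind; rewrite (starYe a3 2%N) Ye ?diagram_autE /lowering /= ?s8 ?w2 // /tab ?YZ /lowering /= ?norm.
have w4 d : (d < 8)%N -> star e`_4 e`_d = tab 4%N d.
  by move: d; apply: nat8_ind; rewrite (starYe a4 2%N) Ye ?diagram_autE /lowering /= ?s8 ?w2 // /tab ?YZ /lowering /= ?norm.
have w5 d : (d < 8)%N -> star e`_5 e`_d = tab 5%N d.
  by move: d; apply: nat8_ind; rewrite (starYe a4 3%N) Ye ?diagram_autE /lowering /= ?s8 ?w3 // /tab ?YZ /lowering /= ?norm.
have w6 d : (d < 8)%N -> star e`_6 e`_d = tab 6%N d.
  by move: d; apply: nat8_ind; rewrite (starYe a2 5%N) Ye ?diagram_autE /lowering /= ?s8 ?w5 // /tab ?YZ /lowering /= ?norm.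
have w7 d : (d < 8)%N -> star e`_7 e`_d = tab 7%N d.
  by move: d; apply: nat8_ind; rewrite (starYe a1 6%N) Ye ?diagram_autE /lowering /= ?s8 ?w6 // /tab ?YZ /lowering /= ?norm.
by move: a; apply: nat8_ind.
Qed.

Lemma star_scalar_neq0 u w : star u w != 0 -> star_scalar != 0.
Proof.
apply: contraNneq => l0; rewrite (weight_coef_sum e_basis u) linear_sumlz big1 // => a _.
rewrite (weight_coef_sum e_basis w) linear_sumr big1 // => d _.
by rewrite linearZl_LR linearZr_LR /= star_weight // l0 scale0r !scaler0.
Qed.
End StarTable.

(** * Coordinate subspaces and their products *)

Definition weight_span (k : fieldType) (V : vectType k) (e : seq V) (J : seq nat) :
  {vspace V} := <<[seq e`_a | a <- J]>>%VS.

(** The weights reached from 0 by lowering steps other than [d]. With a3 excluded the last step is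
    along a4, hence the index 4 in the third row. *)
Definition standard_weights (d : 'I_4) : seq nat :=
  (nth [::] [:: [:: 0]; [:: 0; 1]; [:: 0; 1; 2; 4]; [:: 0; 1; 2; 3]] d)%N.

Section WeightSpan.
Variables (k : fieldType) (V : vectType k) (e : 8.-tuple V).
Hypothesis e_basis : basis_of fullv e.
Local Notation c := (weight_coef e).
Local Notation span_of := (weight_span e).

Lemma mem_weight_span a J : a \in J -> e`_a \in span_of J.
Proof. by move=> aJ; apply/memv_span/map_f. Qed.

Lemma weight_span_sub J (U : {vspace V}) :
  (forall a, a \in J -> e`_a \in U) -> (span_of J <= U)%VS.
Proof. by move=> h; apply/span_subvP => _ /mapP[a aJ ->]; apply: h. Qed.

Lemma weight_spanP J u : reflect (forall a, (a < 8)%N -> a \notin J -> c a u = 0)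
  (u \in span_of J).
Proof.
apply: (iffP idP) => [uJ a lta aJ|h].
  have : (span_of J <= lker (linfun (coord e (Ordinal lta) : V -> k^o)))%VS.
    apply: weight_span_sub => d dJ; rewrite memv_ker lfunE /= -weight_coef_ord /=.
    case: (ltnP d 8) => [ltd|led]; last by rewrite nth_default ?size_tuple // weight_coef0.
    by rewrite weight_coef_e //= (_ : (d == a) = false) //; apply: contraNF aJ => /eqP <-.
  by move/subvP/(_ _ uJ); rewrite memv_ker lfunE /= -weight_coef_ord => /eqP.
rewrite (weight_coef_sum e_basis u); apply: memv_suml => i _.
case: (boolP (val i \in J)) => [iJ|iJ]; first by rewrite memvZ ?mem_weight_span.
by rewrite h // scale0r mem0v.
Qed.

Lemma fullv_weight_span : fullv = span_of (iota 0 8).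
Proof.
apply/eqP; rewrite eqEsubv subvf andbT; apply/subvP => u _.
by apply/weight_spanP => a lta; rewrite mem_iota lta.
Qed.

Lemma dim_weight_span J : uniq J -> all (gtn 8) J -> \dim (span_of J) = size J.
Proof.
move=> uJ /allP ltJ; rewrite -(size_map (nth 0 e)); apply/eqP.
rewrite -[_ == _]/(free _).
pose J' := [seq a <- iota 0 8 | a \notin J].
have pJ : perm_eq (J ++ J') (iota 0 8).
  apply: uniq_perm; rewrite ?iota_uniq ?cat_uniq ?uJ ?filter_uniq ?iota_uniq // ?andbT.
    by rewrite -all_predC; apply/allP => a; rewrite mem_filter => /andP[].
  move=> a; rewrite mem_cat mem_filter mem_iota /=.
  by case: (boolP (a \in J)) => //= /ltJ /= ->.
have : free [seq e`_a | a <- J ++ J'].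
  rewrite (perm_free (perm_map _ pJ)) (_ : map _ _ = e) ?(basis_free e_basis) //.
  by rewrite -[RHS](mkseq_nth 0) size_tuple.
by rewrite map_cat => /catl_free.
Qed.

End WeightSpan.

(** No row of the table repeats an actual weight, so a coordinate of e_a * u involves a single
    coordinate of [u]. *)
Lemma star_index_injr a d j : (a < 8)%N -> (d < 8)%N -> (star_index a d < 8)%N ->
  (j < 8)%N -> j != d -> star_index a j != star_index a d.
Proof.
pose P a d j := (star_index a d < 8)%N ==> (j != d) ==> (star_index a j != star_index a d).
have h : all (fun a => all (fun d => all (P a d) (iota 0 8)) (iota 0 8)) (iota 0 8).
  by vm_compute.
move=> lta ltd ltad ltj nj; move: h.
move=> /allP/(_ a); rewrite mem_iota => /(_ lta)/allP/(_ d).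
rewrite mem_iota => /(_ ltd)/allP/(_ j); rewrite mem_iota => /(_ ltj).
by rewrite /P ltad nj.
Qed.

Lemma star_index_injl a d j : (a < 8)%N -> (d < 8)%N -> (star_index d a < 8)%N ->
  (j < 8)%N -> j != d -> star_index j a != star_index d a.
Proof.
pose P a d j := (star_index d a < 8)%N ==> (j != d) ==> (star_index j a != star_index d a).
have h : all (fun a => all (fun d => all (P a d) (iota 0 8)) (iota 0 8)) (iota 0 8).
  by vm_compute.
move=> lta ltd ltad ltj nj; move: h.
move=> /allP/(_ a); rewrite mem_iota => /(_ lta)/allP/(_ d).
rewrite mem_iota => /(_ ltd)/allP/(_ j); rewrite mem_iota => /(_ ltj).
by rewrite /P ltad nj.
Qed.

Section StarSpan.
Variables (k : fieldType) (V : vectType k) (e : 8.-tuple V).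
Hypothesis e_basis : basis_of fullv e.
Local Notation c := (weight_coef e).
Local Notation span_of := (weight_span e).
Variables (star : {bilinear V -> V -> V}) (lam : k) (lam0 : lam != 0).
Hypothesis starE : forall a, (a < 8)%N -> forall d, (d < 8)%N ->
  star e`_a e`_d = lam *: ((-1) ^+ star_sign a d *: e`_(star_index a d)).

(** A test by evaluation: products of basis vectors stay in the span of [K], and every index of [K]
    is attained. *)
Definition star_closed (I J K : seq nat) : bool :=
  [&& all (fun a => all (fun d => (star_index a d == 8%N) || (star_index a d \in K)) J) I,
      all (fun m => has (fun a => has (fun d => star_index a d == m) J) I) K,
      all (gtn 8) I & all (gtn 8) J].

Lemma spprod_sub (I J : seq V) (U : {vspace V}) :
  (forall u w, u \in I -> w \in J -> star u w \in U) ->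
  (spprod star <<I>> <<J>> <= U)%VS.
Proof.
move=> h; apply: (proj2 (spprodP star _ _)) => _ [u [w [uI wJ ->]]].
rewrite (coord_span (X := in_tuple I) uI) (coord_span (X := in_tuple J) wJ).
rewrite linear_sumlz; apply: memv_suml => i _; rewrite linear_sumr; apply: memv_suml => j _.
by rewrite linearZl_LR linearZr_LR !memvZ //; apply: h; apply: mem_nth.
Qed.

Lemma mem_spprod u w (U W : {vspace V}) : u \in U -> w \in W -> star u w \in spprod star U W.
Proof. by move=> uU wW; apply: (proj1 (spprodP star _ _)); exists u, w. Qed.

Lemma spprod_weight_span I J K : star_closed I J K ->
  spprod star (span_of I) (span_of J) = span_of K.
Proof.
case/and4P => /allP hK /allP hS /allP ltI /allP ltJ; apply/eqP; rewrite eqEsubv.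
apply/andP; split.
  apply: spprod_sub => _ _ /mapP[a aI ->] /mapP[d dJ ->].
  rewrite (starE (ltI _ aI) (ltJ _ dJ)) !memvZ //.
  have /allP/(_ d dJ) := hK _ aI; case/orP => [/eqP->|]; last exact: mem_weight_span.
  by rewrite weight_vector8 mem0v.
apply: weight_span_sub => m /hS/hasP[a aI /hasP[d dJ /eqP <-]].
have : star e`_a e`_d \in spprod star (span_of I) (span_of J).
  by rewrite mem_spprod ?mem_weight_span.
rewrite (starE (ltI _ aI) (ltJ _ dJ)) => /(memvZ lam^-1).
rewrite scalerA mulVf // scale1r => /(memvZ ((-1) ^+ star_sign a d)).
by rewrite scalerA -signr_addb addbb scale1r.
Qed.

Lemma star_coef_left a d u : (a < 8)%N -> (d < 8)%N -> (star_index a d < 8)%N ->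
  c (star_index a d) (star e`_a u) = lam * (-1) ^+ star_sign a d * c d u.
Proof.
move=> lta ltd ltad; rewrite {1}(weight_coef_sum e_basis u) linear_sumr weight_coef_sumE.
rewrite (bigD1 (Ordinal ltd)) //= big1 ?addr0 => [|j nj].
  by rewrite linearZr_LR /= starE // !weight_coefZ weight_coef_e // eqxx mulr1; ring.
rewrite linearZr_LR /= starE // !weight_coefZ.
case: (ltnP (star_index a j) 8) => [ltj|lej]; last first.
  by rewrite nth_default ?size_tuple // weight_coef0 !mulr0.
by rewrite weight_coef_e // (negPf (star_index_injr lta ltd ltad (ltn_ord j) nj)) !mulr0.
Qed.

Lemma star_coef_right a d u : (a < 8)%N -> (d < 8)%N -> (star_index d a < 8)%N ->
  c (star_index d a) (star u e`_a) = lam * (-1) ^+ star_sign d a * c d u.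
Proof.
move=> lta ltd ltad; rewrite {1}(weight_coef_sum e_basis u) linear_sumlz weight_coef_sumE.
rewrite (bigD1 (Ordinal ltd)) //= big1 ?addr0 => [|j nj].
  by rewrite linearZl_LR /= starE // !weight_coefZ weight_coef_e // eqxx mulr1; ring.
rewrite linearZl_LR /= starE // !weight_coefZ.
case: (ltnP (star_index j a) 8) => [ltj|lej]; last first.
  by rewrite nth_default ?size_tuple // weight_coef0 !mulr0.
by rewrite weight_coef_e // (negPf (star_index_injl lta ltd ltad (ltn_ord j) nj)) !mulr0.
Qed.

Lemma star_left_ann u :
  (forall a, a \in standard_weights a3 -> star e`_a u = 0) -> u \in span_of [:: 0%N].
Proof.
move=> h; have z a d : a \in standard_weights a3 -> (d < 8)%N ->
    (star_index a d < 8)%N -> c d u = 0.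
  move=> aJ ltd ltad; have lta : (a < 8)%N by have /allP/(_ _ aJ) : all (gtn 8) (standard_weights a3).
  have := star_coef_left u lta ltd ltad; rewrite h // weight_coef0 => /esym/eqP.
  by rewrite !mulf_eq0 signr_eq0 (negPf lam0) => /eqP.
apply/(weight_spanP e_basis); apply: nat8_ind => // _.
(* For each weight d from 1 to 7, some [a] among 0, 1, 2 for which e_a * e_d is nonzero. *)
- exact: (z 2%N).
- exact: (z 1%N).
- exact: (z 1%N).
- exact: (z 0%N).
- exact: (z 0%N).
- exact: (z 0%N).
- exact: (z 0%N).
Qed.

Lemma star_right_ann u :
  (forall a, a \in standard_weights a4 -> star u e`_a = 0) -> u \in span_of [:: 0%N].
Proof.
move=> h; have z a d : a \in standard_weights a4 -> (d < 8)%N ->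
    (star_index d a < 8)%N -> c d u = 0.
  move=> aJ ltd ltad; have lta : (a < 8)%N by have /allP/(_ _ aJ) : all (gtn 8) (standard_weights a4).
  have := star_coef_right u lta ltd ltad; rewrite h // weight_coef0 => /esym/eqP.
  by rewrite !mulf_eq0 signr_eq0 (negPf lam0) => /eqP.
apply/(weight_spanP e_basis); apply: nat8_ind => // _.
- exact: (z 2%N).
- exact: (z 1%N).
- exact: (z 0%N).
- exact: (z 1%N).
- exact: (z 0%N).
- exact: (z 0%N).
- exact: (z 0%N).
Qed.

Lemma standard_products :
  [/\ spprod star (span_of [:: 0%N]) fullv = span_of (standard_weights a3),
      spprod star fullv (span_of [:: 0%N]) = span_of (standard_weights a4) &
      spprod star (span_of (standard_weights a2))
        (spprod star fullv (span_of (standard_weights a2))) =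
      span_of (standard_weights a2)].
Proof.
rewrite (fullv_weight_span e_basis); split.
- by apply: spprod_weight_span; vm_compute.
- by apply: spprod_weight_span; vm_compute.
(* For the standard a2-space X, V * X is the span of e_0, ..., e_5, which is the orthogonal of X. *)
- rewrite (@spprod_weight_span _ _ (iota 0 6)); last by vm_compute.
  by apply: spprod_weight_span; vm_compute.
Qed.
End StarSpan.

(** * The standard spaces *)

Section Stabilizers.
Variables (k : fieldType) (G : groupType).
Variables (V : vectType k) (rho : G -> 'End(V)) (rho_repr : representation rho).

Lemma lker_repr g : lker (rho g) = 0%VS.
Proof. by apply/eqP/lker0P/can_inj/repr_invK. Qed.

Lemma dim_repr g (W : {vspace V}) : \dim (rho g @: W)%VS = \dim W.
Proof. by rewrite limg_dim_eq // lker_repr capv0. Qed.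

Lemma repr_img_full g : (rho g @: fullv)%VS = fullv.
Proof. by apply/eqP; rewrite eqEdim subvf dim_repr /=. Qed.

Lemma repr_img_mul g h (W : {vspace V}) : (rho (g * h)%g @: W = rho g @: (rho h @: W))%VS.
Proof. by rewrite (proj2 rho_repr) limg_comp. Qed.

Lemma repr_img_one (W : {vspace V}) : (rho 1%g @: W = W)%VS.
Proof. by rewrite (proj1 rho_repr) lim1g. Qed.

Lemma repr_img_inv g (U W : {vspace V}) : (rho g @: U = W -> rho g^-1%g @: W = U)%VS.
Proof. by move=> <-; rewrite -repr_img_mul mulVg repr_img_one. Qed.

Lemma stabilizer_subgroup (W : {vspace V}) : subgroup (stabilizer rho W).
Proof.
split=> [|g h hg hh|g hg]; first exact: repr_img_one.
  by rewrite /stabilizer repr_img_mul hh.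
exact: repr_img_inv.
Qed.

Lemma stabilizer_sub g (W : {vspace V}) : (rho g @: W <= W)%VS -> stabilizer rho W g.
Proof. by move=> h; apply/eqP; rewrite eqEdim h dim_repr /=. Qed.

Lemma stabilizer_conj g h (W : {vspace V}) :
  stabilizer rho (rho g @: W)%VS h <-> stabilizer rho W (g^-1 * h * g)%g.
Proof.
rewrite /stabilizer !repr_img_mul; split=> [->|].
  by rewrite -repr_img_mul mulVg repr_img_one.
by move/repr_img_inv; rewrite invgK => {2}->.
Qed.
End Stabilizers.

Lemma standard_raising d i a : a \in standard_weights d ->
  raising i a = 8%N \/ raising i a \in standard_weights d.
Proof.
have h : all (fun a => (raising i a == 8%N) || (raising i a \in standard_weights d))
    (standard_weights d).
  by move: d; apply: I4P; move: i; apply: I4P; vm_compute.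
by move=> aJ; have /orP[/eqP|] := allP h a aJ; [left|right].
Qed.

Lemma standard_lowering d i a : i != d -> a \in standard_weights d ->
  lowering i a = 8%N \/ lowering i a \in standard_weights d.
Proof.
move=> id; have h : all (fun a => (lowering i a == 8%N) || (lowering i a \in standard_weights d))
    (standard_weights d).
  by move: d id; apply: I4P; move: i; apply: I4P => id; vm_compute.
by move=> aJ; have /orP[/eqP|] := allP h a aJ; [left|right].
Qed.

Lemma component_neq d i : d != a1 -> component d i -> i != d.
Proof.
move=> d1 /connectP[p pth ->]; have : a1 != d by rewrite eq_sym.
by elim: p (a1) pth => //= j p IH i0 /andP[/and3P[_ jd _]] /IH h _; apply: h.
Qed.

Lemma component_a1 d : component d a1.
Proof. exact: connect0. Qed.

Lemma component_a2 d : d != a1 -> d != a2 -> component d a2.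
Proof.
by move=> d1 d2; apply: connect1; rewrite ![_ == d]eq_sym d1 d2.
Qed.

Lemma component_leaf d i : d != a1 -> d != a2 -> i != d -> i != a1 -> i != a2 -> component d i.
Proof.
move=> d1 d2 id i1 i2; apply: connect_trans (component_a2 d1 d2) _.
by apply: connect1; rewrite (eq_sym a2 d) d2 id /cartan (eq_sym a2 i) (negPf i2).
Qed.

Section StandardSpaces.
Variables (k : fieldType) (G : groupType) (x : rootlat -> k -> G).
Hypothesis xrel : steinberg_relations x.
Variables (V : vectType k) (rho : G -> 'End(V)) (rho_repr : representation rho).
Variables (e : 8.-tuple V) (X Y : 'I_4 -> 'End(V)) (mod_e : weight_model x rho e X Y).
Let e_basis := model_basis mod_e.
Local Notation std d := (weight_span e (standard_weights d)).

Lemma standard_pos d i s : stabilizer rho (std d) (x (simple i) s).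
Proof.
apply: stabilizer_sub => //; rewrite limg_span; apply/span_subvP.
move=> _ /mapP[_ /mapP[a aJ ->] ->].
rewrite (model_pos mod_e) (model_X mod_e) memvD ?memvZ //; first exact: mem_weight_span.
by case: (standard_raising i aJ) => [->|]; [rewrite weight_vector8 mem0v | exact: mem_weight_span].
Qed.

Lemma standard_neg d i s : i != d -> stabilizer rho (std d) (x (- simple i) s).
Proof.
move=> id; apply: stabilizer_sub => //; rewrite limg_span; apply/span_subvP.
move=> _ /mapP[_ /mapP[a aJ ->] ->].
rewrite (model_neg mod_e) (model_Y mod_e) memvD ?memvZ //; first exact: mem_weight_span.
by case: (standard_lowering id aJ) => [->|]; [rewrite weight_vector8 mem0v | exact: mem_weight_span].
Qed.

Lemma standard_neg_self d s : s != 0 -> ~ stabilizer rho (std d) (x (- simple d) s).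
Proof.
(* The one weight of the standard space that a_d lowers out of it. *)
move=> s0 st; have [a [aJ ltl lJ]] : exists a, [/\ a \in standard_weights d,
    (lowering d a < 8)%N & lowering d a \notin standard_weights d].
  by move: d {st}; apply: I4P; [exists 0%N | exists 1%N | exists 2%N | exists 2%N].
have : rho (x (- simple d) s) e`_a \in std d by have := memv_img (rho (x (- simple d) s)) (mem_weight_span e aJ); rewrite st.
rewrite (model_neg mod_e) (model_Y mod_e) => h; have := memvB h (mem_weight_span e aJ).
rewrite addrC addKr => /(weight_spanP e_basis) /(_ _ ltl lJ)/eqP.
by rewrite weight_coefZ weight_coef_e // eqxx mulr1 (negPf s0).
Qed.

(** One inclusion holds because the Levi subgroup stabilizes the coordinate space. For the other,
    lowering steps from e_0 inside the component reach every basis vector of that space. *)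
Lemma standard_spaceP d U : standard_space x rho e`_0 d U <-> U = std d.
Proof.
rewrite /standard_space; have [->|d1] := eqVneq d a1.
  by rewrite /weight_span /= span_seq1.
have Lstd g : levi x d g -> stabilizer rho (std d) g.
  apply: generated_sub => [|_ [r [s [rr /forallP supp ->]]]].
    exact: stabilizer_subgroup.
  apply: (subgroup_roots xrel (stabilizer_subgroup rho_repr _) (I := component d)) => //.
  - by move=> i _ t; apply: standard_pos.
  - by move=> i ci t; apply: standard_neg; apply: component_neq.
  - by move=> i ri; apply: (implyP (supp i)).
have e0std : e`_0 \in std d.
  by apply: mem_weight_span; move: d {d1 Lstd}; apply: I4P.
have orbit_std u : (exists2 g, levi x d g & u = rho g e`_0) -> u \in std d.
  by case=> g /Lstd st ->; rewrite -st memv_img.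
suff std_sub (W : {vspace V}) : (forall u, (exists2 g, levi x d g & u = rho g e`_0) -> u \in W) ->
    (std d <= W)%VS.
  split=> [[h1 h2]|->]; last by split.
  by apply/eqP; rewrite eqEsubv h2 // std_sub.
move=> hW.
have Ly i g : component d i -> levi x d g -> levi x d (x (- simple i) 1 * g)%g.
  move=> ci Lg; apply: gen_mul Lg; apply: gen_base; exists (- simple i), 1; split=> //.
    by rewrite is_rootN is_root_simple.
  apply/forallP => j; rewrite mxE simpleE.
  by case: (i =P j) => [<-|_]; rewrite ?oppr0 ?eqxx ?ci ?implybT.
(* As x_(-i)(1) = 1 + Y_i, applying Y_i to an orbit vector gives a difference of two orbit
   vectors. *)
have WY i g : component d i -> levi x d g -> Y i (rho g e`_0) \in W.
  move=> ci Lg; have Lyg := Ly i g ci Lg.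
  have -> : Y i (rho g e`_0) = rho (x (- simple i) 1 * g)%g e`_0 - rho g e`_0.
    by rewrite repr_mul // (model_neg mod_e) scale1r addrC addKr.
  by rewrite memvB //; apply: hW; [exists (x (- simple i) 1 * g)%g | exists g].
have L1 : levi x d 1%g := gen_one _.
have L2 := Ly _ _ (component_a1 d) L1.
pose norm := (repr_mul rho_repr, repr_one rho_repr, model_neg mod_e, scale1r, linearD, model_Y mod_e).
have e0W : e`_0 \in W by apply: hW; exists 1%g; rewrite ?repr_one.
have e1W : e`_1 \in W by have := WY _ _ (component_a1 d) L1; rewrite !norm.
apply: weight_span_sub; have [d2|d2] := eqVneq d a2.
  by rewrite d2 => a; rewrite !inE => /orP[] /eqP->.
have L3 := Ly _ _ (component_a2 d1 d2) L2.
have e2W : e`_2 \in W.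
  have := WY _ _ (component_a2 d1 d2) L2; rewrite !norm /= !(model_Y mod_e).
  by rewrite /lowering /= weight_vector8 add0r.
have leafW i : i != d -> i != a1 -> i != a2 -> e`_(lowering i 2) \in W.
  move=> id i1 i2; have := WY _ _ (component_leaf d1 d2 id i1 i2) L3; rewrite !norm /=.
  rewrite !(model_Y mod_e).
  have -> : lowering i 0 = 8%N by move: i i1 i2 {id}; apply: I4P.
  have -> : lowering i (lowering a1 0) = 8%N by move: i i1 i2 {id}; apply: I4P.
  have -> : lowering i (lowering a2 0) = 8%N by move: i {i1 i2 id}; apply: I4P.
  by rewrite weight_vector8 !add0r.
move: d d1 d2 leafW {Lstd e0std orbit_std hW WY Ly L1 L2 L3}; apply: I4P => // _ _ leafW a;
  rewrite !inE => /or4P[] /eqP-> //; by [exact: (leafW a3) | exact: (leafW a4)].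
Qed.
End StandardSpaces.

(** * Isotropic vectors and stabilizers *)

Lemma lowering_raising_or i a : lowering i (raising i a) = a \/ lowering i (raising i a) = 8%N.
Proof.
case: (ltnP a 8) => [lta|/(raising_default i) ->]; last by right; apply: lowering_default.
by move: a lta; apply: nat8_ind; move: i; apply: I4P; by [left|right].
Qed.

Section Isotropic.
Variables (k : fieldType) (char_k : [pchar k] =i pred0).
Variables (G : groupType) (x : rootlat -> k -> G).
Variables (V : vectType k) (rho : G -> 'End(V)) (rho_repr : representation rho).
Variables (e : 8.-tuple V) (X Y : 'I_4 -> 'End(V)) (mod_e : weight_model x rho e X Y).
Variable b : {biscalar V}.
Hypothesis b_inv : forall g u w, b (rho g u) (rho g w) = b u w.
Hypothesis b_nondeg : nondegenerate_form b.
Let e_basis := model_basis mod_e.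
Local Notation c := (weight_coef e).
Local Notation span_of := (weight_span e).
Local Notation std d := (weight_span e (standard_weights d)).

Let two_neq0 : 2%:R != 0 :> k.
Proof. by rewrite (natr_eq0_char0 char_k). Qed.

(* Invariance under 1 + X and 1 - X gives infinitesimal invariance. *)
Lemma form_skew (f : k -> G) (Z : 'End(V)) :
  (forall s u, rho (f s) u = u + s *: Z u) -> forall u w, b (Z u) w = - b u (Z w).
Proof.
move=> fE u w; have bE s : s * (b (Z u) w + b u (Z w)) + s * s * b (Z u) (Z w) = 0.
  have := b_inv (f s) u w; rewrite !fE linearDl !linearDr !linearZl_LR /= !linearZr_LR /=.
  by move/eqP; rewrite -subr_eq0 => /eqP <-; ring.
apply/eqP; rewrite -addr_eq0; have := bE 1; have := bE (-1).
set P := _ + b u (Z w); set Q := b (Z u) (Z w) => h1 h2.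
have : 2%:R * P = 0.
  transitivity ((1 * P + 1 * 1 * Q) - (-1 * P + -1 * -1 * Q)); first by ring.
  by rewrite h1 h2 subrr.
by move/eqP; rewrite mulf_eq0 (negPf two_neq0).
Qed.

Let bX i := form_skew (model_pos mod_e i).
Let bY i := form_skew (model_neg mod_e i).

Lemma form_explicit u w : b u w = b e`_0 e`_7 *
  (c 0%N u * c 7%N w - c 1%N u * c 6%N w + c 2%N u * c 5%N w - c 3%N u * c 4%N w
   - c 4%N u * c 3%N w + c 5%N u * c 2%N w - c 6%N u * c 1%N w + c 7%N u * c 0%N w).
Proof.
rewrite (form_coefs e_basis (model_X mod_e) (model_Y mod_e) bX bY); congr (_ * _).
by rewrite !big_ord_recl big_ord0 /= /bump /=; ring.
Qed.

Lemma form_scalar_neq0 : b e`_0 e`_7 != 0.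
Proof.
apply/eqP => b0; have : e`_0 = 0 by apply: b_nondeg => w; rewrite form_explicit b0 mul0r.
move/(congr1 (c 0%N)); rewrite weight_coef_e // weight_coef0 => /eqP.
by rewrite oner_eq0.
Qed.

(** The quadratic form is twice this expression up to a nonzero scalar, hence the division by 2. *)
Lemma isotropic_coefs u : b u u = 0 ->
  c 0%N u * c 7%N u - c 1%N u * c 6%N u + c 2%N u * c 5%N u - c 3%N u * c 4%N u = 0.
Proof.
move/eqP; rewrite form_explicit mulf_eq0 (negPf form_scalar_neq0) /= => /eqP h.
apply/eqP; rewrite -(mulrI_eq0 _ (mulfI two_neq0)); apply/eqP; rewrite -[RHS]h; ring.
Qed.

Lemma orthogonal_coef a u : (a < 8)%N -> b u e`_a = 0 -> c (7 - a)%N u = 0.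
Proof.
move=> lta /eqP; rewrite form_explicit mulf_eq0 (negPf form_scalar_neq0) /= !weight_coef_e //.
move=> /eqP h; have /eqP : (-1) ^+ weight_sign a * c (7 - a)%N u = 0.
  by rewrite -[RHS]h; move: a lta {h}; apply: nat8_ind; rewrite /=; ring.
by rewrite mulf_eq0 signr_eq0 => /eqP.
Qed.

Let cP i s a u : c a (rho (x (simple i) s) u) = c a u + s * c (lowering i a) u.
Proof.
by rewrite (model_pos mod_e) weight_coefD weight_coefZ (weight_coef_X mod_e).
Qed.

Let cN i s a u : c a (rho (x (- simple i) s) u) = c a u + s * c (raising i a) u.
Proof.
by rewrite (model_neg mod_e) weight_coefD weight_coefZ (weight_coef_Y mod_e).
Qed.

(* One step of Gaussian elimination in SL_2. *)
Lemma clear_weight i m u : (m < 8)%N -> (raising i m < 8)%N ->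
  exists g, c m (rho g u) = 0 /\ forall d, c d u = 0 ->
    c (lowering i d) u = 0 -> c (raising i d) u = 0 -> c d (rho g u) = 0.
Proof.
move=> ltm lta; have la : lowering i (raising i m) = m.
  by apply/eqP; rewrite eq_sym -raising_lowering.
pose y w := x (- simple i) (- c m w / c (raising i m) w).
have y0 w : c (raising i m) w != 0 -> c m (rho (y w) w) = 0.
  by move=> nz; rewrite cN divfK // subrr.
have yd w d : c d w = 0 -> c (raising i d) w = 0 -> c d (rho (y w) w) = 0.
  by move=> h1 h2; rewrite cN h1 h2 mulr0 addr0.
have [z|nz] := eqVneq (c (raising i m) u) 0; last first.
  by exists (y u); split=> [|d h1 h2 h3]; [exact: y0 | exact: yd].
have [cm|nz] := eqVneq (c m u) 0; first by exists 1%g; rewrite repr_one.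
(* The pivot is zero, so the coordinate to be cleared is first added to it. *)
pose w := rho (x (simple i) 1) u; exists (y w * x (simple i) 1)%g.
rewrite repr_mul //; split=> [|d h1 h2 h3].
  by apply: y0; rewrite cP la z add0r mul1r.
apply: yd; rewrite cP; first by rewrite h1 h2 mulr0 addr0.
rewrite h3 add0r mul1r; have [->//|->] := lowering_raising_or i d.
exact: weight_coef_default.
Qed.

(** Coordinates are cleared from index 7 downwards until only that of e_0 remains. Isotropy
    intervenes at the weights 3 and 4, neither of which can be cleared against the other. *)
Lemma isotropic_transitive u : u != 0 -> b u u = 0 ->
  exists g s, s != 0 /\ rho g u = s *: e`_0.
Proof.
move=> u0 buu; pose P m := exists g, forall d, (m <= d)%N -> c d (rho g u) = 0.
have step i m : P m.+1 -> (m < 8)%N -> (raising i m < 8)%N ->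
    (forall d, (m < d < 8)%N -> (m < lowering i d)%N && (m < raising i d)%N) -> P m.
  case=> g hg ltm lta h; have [g' [h1 h2]] := clear_weight (rho g u) ltm lta.
  exists (g' * g)%g => d; rewrite repr_mul // leq_eqVlt => /orP[/eqP <- //|md].
  case: (ltnP d 8) => [d8|/weight_coef_default //].
  by have /andP[? ?] : (m < lowering i d)%N && (m < raising i d)%N; [apply: h; rewrite md | apply: h2; apply: hg].
have P8 : P 8%N by exists 1%g => d; apply: weight_coef_default.
have P7 : P 7%N by apply: (step a1) => //; do 8!case=> //.
have P6 : P 6%N by apply: (step a2) => //; do 8!case=> //.
have [g hg] : P 5%N by apply: (step a3) => //; do 8!case=> //.
(* With coordinates 5, 6 and 7 zero, the quadric reads c_3 c_4 = 0. The coordinate that may survive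
   is cleared against coordinate 2, by a3 or a4. *)
have P3 : P 3%N.
  have := isotropic_coefs (etrans (b_inv g u u) buu).
  rewrite (hg 7%N) // (hg 6%N) // (hg 5%N) // !mulr0 subrr add0r sub0r => /eqP; rewrite oppr_eq0 mulf_eq0.
  case/orP => /eqP z.
    have [||g' [h1 h2]] := @clear_weight a4 4%N (rho g u) => //.
    exists (g' * g)%g => d; rewrite repr_mul //.
    case: d => [|[|[|[|[|d]]]]] // _; apply: h2; [exact: z | exact: (hg 5%N) | exact: (hg 8%N) | exact: hg | |];
      case: d => [|[|[|d]]]; by [exact: z | exact: (hg 8%N) | rewrite lowering_default // hg | rewrite raising_default // hg].
  have [||g' [h1 h2]] := @clear_weight a3 3%N (rho g u) => //.
  exists (g' * g)%g => d; rewrite repr_mul //.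
  case: d => [|[|[|[|[|d]]]]] // _; apply: h2; [exact: z | exact: (hg 5%N) | exact: (hg 8%N) | exact: hg | |];
    case: d => [|[|[|d]]]; by [exact: z | exact: (hg 8%N) | rewrite lowering_default // hg | rewrite raising_default // hg].
have P2 : P 2%N by apply: (step a2) => //; do 8!case=> //.
have [g' hg'] : P 1%N by apply: (step a1) => //; do 8!case=> //.
exists g', (c 0%N (rho g' u)).
have E : rho g' u = c 0%N (rho g' u) *: e`_0.
  apply: (weight_coef_inj e_basis) => a lta; rewrite weight_coefZ weight_coef_e //.
  by case: a lta => [|a] _; rewrite ?mulr1 // mulr0 hg'.
split=> //; apply: contraNneq u0 => z.
by rewrite -(repr_invK rho_repr g' u) E z scale0r linear0.
Qed.
End Isotropic.

(** Some X_i moves the last nonzero coordinate from [j] to a smaller index without jumping over [m].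
    The bound m <= 2 is sharp: from 4 the only raising step leads to 2, past 3. *)
Lemma raising_step j : (0 < j < 8)%N -> exists2 i, (raising i j < j)%N &
  [/\ forall m, (m <= 2)%N -> (m < j)%N -> (m <= raising i j)%N,
     lowering i (raising i j) = j &
     forall d, (raising i j < d)%N -> (j < lowering i d)%N].
Proof.
move=> /andP[j0 j8]; pose i := nth a1 [:: a1; a1; a2; a3; a4; a4; a2; a1] j.
have : [&& (raising i j < j)%N,
    all (fun m => (m < j)%N ==> (m <= raising i j)%N) [:: 0; 1; 2]%N,
    lowering i (raising i j) == j &
    all (fun d => (raising i j < d)%N ==> (j < lowering i d)%N) (iota 0 8)].
  by move: j j8 j0 @i; apply: nat8_ind => //; vm_compute.
case/and4P => h1 /allP h2 /eqP h3 /allP h4; exists i => //; split=> // [m m2 mj|d].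
  by apply: (implyP (h2 m _)) => //; case: m m2 {mj} => [|[|[|]]].
case: (ltnP d 8) => [d8|/lowering_default -> //].
by move=> hd; apply: (implyP (h4 d _)) => //; rewrite mem_iota.
Qed.

(** * Isotropic subspaces stable under the positive root vectors, and separation of objects by
    stabilizers *)

Section Flags.
Variables (k : fieldType) (char_k : [pchar k] =i pred0).
Variables (G : groupType) (x : rootlat -> k -> G) (xrel : steinberg_relations x).
Variables (V : vectType k) (rho : G -> 'End(V)) (rho_repr : representation rho).
Variables (e : 8.-tuple V) (X Y : 'I_4 -> 'End(V)) (mod_e : weight_model x rho e X Y).
Variable b : {biscalar V}.
Hypothesis b_inv : forall g u w, b (rho g u) (rho g w) = b u w.
Hypothesis b_nondeg : nondegenerate_form b.
Let e_basis := model_basis mod_e.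
Local Notation c := (weight_coef e).
Local Notation span_of := (weight_span e).
Local Notation std d := (weight_span e (standard_weights d)).

Section Stable.
Variable W : {vspace V}.
Hypothesis W_stable : forall i u, u \in W -> X i u \in W.

Lemma stable_leading m j u : (m <= 2)%N -> (m <= j < 8)%N -> u \in W -> c j u != 0 ->
  (forall d, (j < d)%N -> c d u = 0) ->
  exists w, [/\ w \in W, c m w != 0 & forall d, (m < d)%N -> c d w = 0].
Proof.
move=> m2; have [n] := ubnP j; elim: n j u => // n IH j u; rewrite ltnS => jn.
case/andP; rewrite leq_eqVlt => /orP[/eqP -> _ uW nz hz|mj j8 uW nz hz].
  by exists u.
have [|i ltj [hm hl hd]] := @raising_step j; first by rewrite j8 (leq_trans _ mj).
apply: (IH (raising i j) (X i u)).
- exact: leq_trans ltj jn.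
- by rewrite hm //= (ltn_trans ltj).
- exact: W_stable.
- by rewrite (weight_coef_X mod_e) hl.
- by move=> d /hd/hz; rewrite (weight_coef_X mod_e).
Qed.

(** A vector of [W] outside the span of e_0, ..., e_(m-1) is pushed up until its last coordinate is
    the m-th; the earlier coordinates are then subtracted inside [W]. *)
Lemma stable_flag m : (m <= 2)%N -> (span_of (iota 0 m) <= W)%VS -> (m < \dim W)%N ->
  e`_m \in W.
Proof.
move=> m2 sub lt_m.
have [u uW un] : exists2 u, u \in W & u \notin span_of (iota 0 m).
  apply/subvPn; apply: contraTN lt_m => /dimvS; rewrite -leqNgt.
  rewrite (dim_weight_span e_basis) ?size_iota ?iota_uniq //.
  by apply/allP => a; rewrite mem_iota /= add0n => /leq_trans; apply; apply: leq_trans m2 _.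
have [a0 ma0 nz0] : exists2 a : 'I_8, (m <= a)%N & c a u != 0.
  apply/exists_inP; apply: contraR un; rewrite negb_exists => /forallP h.
  apply/(weight_spanP e_basis) => a a8; rewrite mem_iota /= add0n -leqNgt => ma.
  by have := h (Ordinal a8); rewrite /= ma /= negbK => /eqP.
case: (@arg_maxnP _ a0 (fun a : 'I_8 => c a u != 0) val nz0) => j nz hj.
have [|d jd|w [wW wm hw]] := @stable_leading m j u m2 _ uW nz.
- by rewrite (leq_trans ma0 (hj _ nz0)) /=.
- case: (ltnP d 8) => [d8|]; last exact: weight_coef_default.
  by apply: contraTeq jd => /(hj (Ordinal d8)) /=; rewrite -leqNgt.
have -> : e`_m = (c m w)^-1 *: (w - \sum_(a < m) c a w *: e`_a).
  have m8 : (m < 8)%N by apply: leq_ltn_trans m2 _.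
  apply: (weight_coef_inj e_basis) => a a8.
  rewrite weight_coefZ weight_coefD weight_coefN weight_coef_sumE weight_coef_e //.
  under eq_bigr => i _ do rewrite weight_coefZ (weight_coef_e e_basis _ (ltn_trans (ltn_ord i) m8)).
  case: (ltngtP m a) => [ma|am|<-].
  - rewrite (hw a) // big1 ?subr0 ?mulr0 // => i _.
    by rewrite ltn_eqF ?mulr0 // (ltn_trans _ ma).
  - rewrite (bigD1 (Ordinal am)) //= eqxx mulr1 big1 ?addr0 ?subrr ?mulr0 // => i.
    by rewrite -val_eqE /= => /negPf ->; rewrite mulr0.
  - by rewrite big1 ?subr0 ?mulVf // => i _; rewrite ltn_eqF ?mulr0.
rewrite memvZ // memvB // memv_suml // => a _; rewrite memvZ //.
by apply: (subvP sub); rewrite mem_weight_span // mem_iota /=.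
Qed.

Lemma stable_flag_sub m : (m <= 3)%N -> (m <= \dim W)%N -> (span_of (iota 0 m) <= W)%VS.
Proof.
elim: m => [|m IH] m3 mW; first by rewrite /weight_span /= span_nil sub0v.
have sub := IH (ltnW m3) (ltnW mW).
apply: weight_span_sub => a; rewrite mem_iota /= add0n ltnS leq_eqVlt.
case/orP => [/eqP ->|am]; first exact: stable_flag.
by apply: (subvP sub); rewrite mem_weight_span // mem_iota.
Qed.

(** In dimension 4, [W] contains e_0, e_1, e_2. Orthogonality to them and c_3 c_4 = 0 leave either
    e_4 or e_3 as the fourth basis vector, the two families of maximal isotropic subspaces. *)
Lemma stable_isotropic_standard : (forall u w, u \in W -> w \in W -> b u w = 0) ->
  \dim W \in [:: 1%N; 2%N; 4%N] -> exists d, W = std d.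
Proof.
move=> iso; rewrite !inE => /or3P[] /eqP dimW.
- exists a1; apply/esym/eqP; rewrite eqEdim dimW (dim_weight_span e_basis) // andbT.
  by apply: (@stable_flag_sub 1); rewrite ?dimW.
- exists a2; apply/esym/eqP; rewrite eqEdim dimW (dim_weight_span e_basis) // andbT.
  by apply: (@stable_flag_sub 2); rewrite ?dimW.
have sub : (span_of (iota 0 3) <= W)%VS by apply: stable_flag_sub; rewrite ?dimW.
have [u uW un] : exists2 u, u \in W & u \notin span_of (iota 0 3).
  apply/subvPn; apply: contraTN isT => /dimvS.
  by rewrite dimW (dim_weight_span e_basis).
have eW a : (a < 3)%N -> e`_a \in W.
  by move=> a3; apply: (subvP sub); rewrite mem_weight_span // mem_iota.
have hi a : (4 < a < 8)%N -> c a u = 0.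
  case/andP => a4 a8; rewrite -(subKn (_ : a <= 7)%N) //.
  apply: (orthogonal_coef char_k mod_e b_inv b_nondeg); first by rewrite ltnS leq_subr.
  by apply: iso => //; apply: eW; lia.
have := isotropic_coefs char_k mod_e b_inv b_nondeg (iso _ _ uW uW).
rewrite (hi 7%N) // (hi 6%N) // (hi 5%N) // !mulr0 subrr add0r sub0r => /eqP.
rewrite oppr_eq0 mulf_eq0 => z.
have uE : u = \sum_(a < 3) c a u *: e`_a + c 3%N u *: e`_3 + c 4%N u *: e`_4.
  rewrite {1}(weight_coef_sum e_basis u) !big_ord_recr big_ord0 /=.
  by rewrite (hi 7%N) // (hi 6%N) // (hi 5%N) // !scale0r !addr0.
have lowW : \sum_(a < 3) c a u *: e`_a \in W.
  by apply: memv_suml => a _; rewrite memvZ // eW.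
have lowS : \sum_(a < 3) c a u *: e`_a \in span_of (iota 0 3).
  by apply: memv_suml => a _; rewrite memvZ // mem_weight_span // mem_iota /=.
have fin d a : (a < 8)%N -> u = \sum_(a < 3) c a u *: e`_a + c a u *: e`_a ->
    standard_weights d =i a :: iota 0 3 -> size (standard_weights d) = 4%N ->
    uniq (standard_weights d) -> W = std d.
  move=> a8 ua dE size_d uniq_d.
  have ca : c a u != 0.
    by apply: contraNneq un => ca; rewrite ua ca scale0r addr0.
  have aW : e`_a \in W.
    rewrite -(scale1r e`_a) -(mulVf ca) -scalerA memvZ //.
    by have := memvB uW lowW; rewrite {1}ua addrC addKr.
  apply/esym/eqP; rewrite eqEdim dimW (dim_weight_span e_basis) ?size_d ?andbT //.
    by apply: weight_span_sub => a'; rewrite dE inE mem_iota => /orP[/eqP ->|/eW].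
  by apply/allP => a'; rewrite dE inE mem_iota /= => /orP[/eqP -> //|/leq_trans ->].
case/orP: z => /eqP z.
  exists a3; apply: (fin _ 4%N) => //; first by rewrite {1}uE z scale0r addr0.
  by move=> a; rewrite !inE; lia.
exists a4; apply: (fin _ 3%N) => //; first by rewrite {1}uE z scale0r addr0.
by move=> a; rewrite !inE; lia.
Qed.
End Stable.

Lemma standard_isotropic d u w : u \in std d -> w \in std d -> b u w = 0.
Proof.
move=> /(weight_spanP e_basis) hu /(weight_spanP e_basis) hw.
rewrite (form_explicit char_k mod_e b_inv); move: d hu hw; apply: I4P => hu hw;
  rewrite ?(hu 7%N, hu 6%N, hu 5%N, hw 7%N, hw 6%N, hw 5%N) // ?mulr0 ?mul0r.
- by rewrite (hu 3%N) // (hw 3%N) //; ring.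
- by rewrite (hu 3%N) // (hw 3%N) //; ring.
- by rewrite (hu 3%N) // (hw 3%N) //; ring.
- by rewrite (hu 4%N) // (hw 4%N) //; ring.
Qed.

(** After conjugation one space is standard, so the other is stable under all X_i and hence standard
    as well. Their types agree because x_(-d') fixes every standard space except that of type d'. *)
Lemma stabilizer_inj g g' d d' :
  (forall h, stabilizer rho (rho g @: std d)%VS h <->
             stabilizer rho (rho g' @: std d')%VS h) ->
  (rho g @: std d = rho g' @: std d')%VS.
Proof.
move=> st; pose W := (rho (g'^-1 * g)%g @: std d)%VS.
have gW : (rho g @: std d = rho g' @: W)%VS.
  by rewrite /W -repr_img_mul // mulgA mulgV mul1g.
have stW h : stabilizer rho W h <-> stabilizer rho (std d') h.
  have := st (g' * h * g'^-1)%g; rewrite gW !stabilizer_conj //.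
  suff -> : (g'^-1 * (g' * h * g'^-1) * g' = h)%g by [].
  by rewrite !mulgA mulVg mul1g -mulgA mulVg mulg1.
have W_stable i u : u \in W -> X i u \in W.
  move=> uW; have h := iffRL (stW _) (standard_pos rho_repr mod_e d' i 1).
  have := memv_img (rho (x (simple i) 1)) uW; rewrite h (model_pos mod_e) scale1r => h'.
  by have := memvB h' uW; rewrite addrC addKr.
have [|| d'' Wd''] := stable_isotropic_standard W_stable.
- move=> _ _ /memv_imgP[u ud ->] /memv_imgP[w wd ->].
  by rewrite b_inv (standard_isotropic ud wd).
- by rewrite dim_repr // (dim_weight_span e_basis); move: (d); apply: I4P.
have [d''d'|ne] := eqVneq d'' d'; first by rewrite gW Wd'' d''d'.
have d'd'' : d' != d'' by rewrite eq_sym.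
have := iffLR (stW (x (- simple d') 1)); rewrite Wd''.
by move=> /(_ (standard_neg rho_repr mod_e 1 d'd''))/(standard_neg_self mod_e (oner_neq0 _)).
Qed.
End Flags.

(** * Equivariance of the product and of the map psi *)

Lemma multiplicative1 (G H : groupType) (f : {multiplicative G -> H}) : f 1%g = 1%g.
Proof. by apply: (@mulgI _ (f 1%g)); rewrite -gmulfM !mulg1. Qed.

Lemma multiplicativeV (G H : groupType) (f : {multiplicative G -> H}) g :
  f g^-1%g = (f g)^-1%g.
Proof. by apply: (@mulgI _ (f g)); rewrite -gmulfM !mulgV multiplicative1. Qed.

Section Triality.
Variables (k : fieldType) (G : groupType) (x : rootlat -> k -> G).
Hypothesis xrel : steinberg_relations x.
Variables (phi : {multiplicative G -> G}) (phi_triality : triality x phi).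

Lemma triality_h_elt i s : phi (h_elt x (simple i) s) = h_elt x (simple (diagram_aut i)) s.
Proof.
have [_ pos neg] := phi_triality; have wE t :
    phi (w_elt x (simple i) t) = w_elt x (simple (diagram_aut i)) t.
  by rewrite /w_elt !gmulfM pos neg.
by rewrite /h_elt gmulfM multiplicativeV !wE.
Qed.

(** phi is given on simple root elements; the remaining positive roots follow because the preimage
    of B is a subgroup. *)
Lemma triality_borel h : borel x h -> borel x (phi h).
Proof.
have [_ pos _] := phi_triality.
have sub (A : G -> Prop) : subgroup (fun g => generated A (phi g)).
  split=> [|g g' h1 h2|g h1]; rewrite ?multiplicative1 ?gmulfM ?multiplicativeV.
  - exact: gen_one.
  - exact: gen_mul.
  - exact: gen_inv.
move=> Bh; rewrite /borel; apply: (generated_sub (sub _) _ Bh) => g [Tg|[r [s [rr pr ->]]]].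
  apply: gen_base; left; rewrite /torus; apply: (generated_sub (sub _) _ Tg) => _ [i [s [s0 ->]]].
  by rewrite triality_h_elt; apply: gen_base; exists (diagram_aut i), s.
apply: (subgroup_pos xrel (sub _) (I := xpredT)) => //.
move=> i _ t.
rewrite pos; apply: gen_base; right; exists (simple (diagram_aut i)), t.
by rewrite positive_simple is_root_simple.
Qed.

Lemma triality_parabolic P : parabolic x P -> parabolic x (fun g => P (phi g)).
Proof.
have o3 := triality_order3 phi_triality; case=> -[P1 PM PV] [g Pg]; split.
  by split=> [|h h' ? ?|h ?]; rewrite ?multiplicative1 ?gmulfM ?multiplicativeV; auto.
(* The conjugator is the preimage of [g], phi^2 being the inverse of phi. *)
exists (phi (phi g)) => h Bh; rewrite !gmulfM multiplicativeV o3.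
by apply: Pg; apply: triality_borel.
Qed.
End Triality.

Section Product.
Variables (k : fieldType) (char_k : [pchar k] =i pred0).
Variables (G : groupType) (x : rootlat -> k -> G) (xrel : steinberg_relations x).
Variables (V : vectType k) (rho : G -> 'End(V)) (rho_repr : representation rho).
Variables (phi : {multiplicative G -> G}) (phi_triality : triality x phi).
Variable star : {bilinear V -> V -> V}.
Hypothesis star_inv : forall g u w,
  star (rho g u) (rho (phi (phi g)) w) = rho (phi g) (star u w).

Let phi3 g : phi (phi (phi g)) = g := triality_order3 phi_triality g.

(** Invariance under f(s) is an identity of degree 2 in [s]; the difference of its cases s = 1 and s
    = -1 isolates the linear part, up to a factor 2. *)
Lemma star_derivation (f : k -> G) (Z Z' Z'' : 'End(V)) :
  (forall s u, rho (f s) u = u + s *: Z u) ->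
  (forall s u, rho (phi (f s)) u = u + s *: Z' u) ->
  (forall s u, rho (phi (phi (f s))) u = u + s *: Z'' u) ->
  forall u w, Z' (star u w) = star (Z u) w + star u (Z'' w).
Proof.
move=> fE fE' fE'' u w.
pose A := Z' (star u w); pose B := star (Z u) w + star u (Z'' w).
pose C := star (Z u) (Z'' w).
have E s : s *: A = s *: B + (s * s) *: C.
  have := star_inv (f s) u w; rewrite fE fE' fE'' linearDl !linearDr.
  rewrite !linearZl_LR !linearZr_LR /= -!addrA => /addrI.
  rewrite scalerDr scalerA => <-; rewrite /B /C.
  by rewrite addrCA addrA.
have := E 1; have := E (-1); rewrite mulrNN mulr1 !scale1r !scaleN1r => h1 h2.
have h3 : A - - A = B + C - (- B + C) by rewrite -h1 -h2.
move: h3; rewrite !opprK opprD opprK addrACA subrr addr0 -!mulr2n => /eqP.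
rewrite -subr_eq0 -mulrnBl -scaler_nat scaler_eq0 (natr_eq0_char0 char_k) /=.
by rewrite subr_eq0 => /eqP.
Qed.

(** The inclusion holds for every group element; used at g^-1 it gives the converse. *)
Lemma spprod_inv g (U W : {vspace V}) :
  (rho (phi g) @: spprod star U W =
   spprod star (rho g @: U) (rho (phi (phi g)) @: W))%VS.
Proof.
have sub h (U' W' : {vspace V}) : (rho (phi h) @: spprod star U' W' <=
    spprod star (rho h @: U') (rho (phi (phi h)) @: W'))%VS.
  set T := spprod _ (_ @: _) _; rewrite -[T](repr_img_one rho_repr) -(mulgV (phi h)).
  rewrite repr_img_mul //; apply: limgS; apply: (proj2 (spprodP star _ _)).
  move=> _ [u [w [uU wW ->]]]; rewrite -(repr_invK rho_repr (phi h) (star u w)).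
  by rewrite memv_img // -star_inv mem_spprod ?memv_img.
apply/eqP; rewrite eqEsubv sub /=.
have := limgS (rho (phi g)) (sub g^-1%g (rho g @: U)%VS (rho (phi (phi g)) @: W)%VS).
rewrite !multiplicativeV -!repr_img_mul // !mulgV !mulVg !repr_img_one //.
Qed.

Lemma spprod_full_inv g (U : {vspace V}) :
  spprod star (rho g @: U)%VS fullv = (rho (phi g) @: spprod star U fullv)%VS.
Proof. by rewrite spprod_inv repr_img_full. Qed.

Lemma full_spprod_inv g (U : {vspace V}) :
  spprod star fullv (rho g @: U)%VS = (rho (phi (phi g)) @: spprod star fullv U)%VS.
Proof. by rewrite spprod_inv phi3 repr_img_full. Qed.

Lemma plane_inv g (U : {vspace V}) :
  spprod star (rho g @: U)%VS (spprod star fullv (rho g @: U)%VS) =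
  (rho (phi g) @: spprod star U (spprod star fullv U))%VS.
Proof. by rewrite full_spprod_inv -spprod_inv. Qed.
End Product.

(** * Comparison of psi with the map induced by phi *)

Section Psi.
Variables (k : fieldType) (char_k : [pchar k] =i pred0).
Variables (G : groupType) (x : rootlat -> k -> G) (xrel : steinberg_relations x).
Variables (V : vectType k) (rho : G -> 'End(V)) (rho_repr : representation rho).
Variables (e : 8.-tuple V) (X Y : 'I_4 -> 'End(V)) (mod_e : weight_model x rho e X Y).
Variables (phi : {multiplicative G -> G}) (phi_triality : triality x phi).
Variable b : {biscalar V}.
Hypothesis b_inv : forall g u w, b (rho g u) (rho g w) = b u w.
Hypothesis b_nondeg : nondegenerate_form b.
Variable star : {bilinear V -> V -> V}.
Hypothesis star_inv : forall g u w,
  star (rho g u) (rho (phi (phi g)) w) = rho (phi g) (star u w).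
Hypothesis star_neq0 : exists u w, star u w != 0.

Let e_basis := model_basis mod_e.
Let phi3 g : phi (phi (phi g)) = g := triality_order3 phi_triality g.
Local Notation span_of := (weight_span e).
Local Notation std d := (weight_span e (standard_weights d)).

Let starX i u w : X (diagram_aut i) (star u w) =
  star (X i u) w + star u (X (diagram_aut (diagram_aut i)) w).
Proof.
have [_ pos _] := phi_triality.
apply: (star_derivation char_k star_inv (f := x (simple i))) => s z; rewrite ?pos;
  exact: model_pos mod_e _ _ _.
Qed.

Let starY i u w : Y (diagram_aut i) (star u w) =
  star (Y i u) w + star u (Y (diagram_aut (diagram_aut i)) w).
Proof.
have [_ _ neg] := phi_triality.
apply: (star_derivation char_k star_inv (f := x (- simple i))) => s z; rewrite ?neg;
  exact: model_neg mod_e _ _ _.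
Qed.

Let lam := star_scalar e star.

Let starE : forall a, (a < 8)%N -> forall d, (d < 8)%N ->
  star e`_a e`_d = lam *: ((-1) ^+ star_sign a d *: e`_(star_index a d)).
Proof.
by move=> a a8 d d8; rewrite (star_weight e_basis (model_X mod_e) (model_Y mod_e) starX starY).
Qed.

Let lam0 : lam != 0.
Proof.
case: star_neq0 => u [w].
exact: (star_scalar_neq0 e_basis (model_X mod_e) (model_Y mod_e) starX starY).
Qed.

Let std1E : std a1 = <[e`_0]>%VS. Proof. by rewrite /weight_span /= span_seq1. Qed.

Let std_products := standard_products e_basis lam0 starE.

Let line_full g : spprod star (rho g @: std a1)%VS fullv = (rho (phi g) @: std a3)%VS.
Proof. by case: std_products => h _ _; rewrite (spprod_full_inv rho_repr star_inv) h. Qed.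

Let full_line g : spprod star fullv (rho g @: std a1)%VS = (rho (phi (phi g)) @: std a4)%VS.
Proof.
by case: std_products => _ h _; rewrite (full_spprod_inv rho_repr phi_triality star_inv) h.
Qed.

Let plane g : spprod star (rho g @: std a2)%VS (spprod star fullv (rho g @: std a2)%VS) =
  (rho (phi g) @: std a2)%VS.
Proof.
by case: std_products => _ _ h; rewrite (plane_inv rho_repr phi_triality star_inv) h.
Qed.

Let e0_neq0 : e`_0 != 0.
Proof.
apply/eqP => /(congr1 (weight_coef e 0%N)); rewrite weight_coef_e // weight_coef0 => /eqP.
by rewrite oner_eq0.
Qed.

Let isotropic_line a : a != 0 -> b a a = 0 -> exists g, <[a]>%VS = (rho g @: std a1)%VS.
Proof.
move=> a0 baa.
have [g [s [s0 ga]]] := isotropic_transitive char_k rho_repr mod_e b_inv b_nondeg a0 baa.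
exists g^-1%g; rewrite std1E limg_line; have -> : a = s *: rho g^-1%g e`_0.
  by rewrite -{1}(repr_invK rho_repr g a) ga linearZ.
by apply/eqP; rewrite eqEsubv -!memvE memvZ ?memv_line //= -[X in X \in _](scalerK s0) memvZ ?memv_line.
Qed.

Let line_isotropic g : rho g e`_0 != 0 /\ b (rho g e`_0) (rho g e`_0) = 0.
Proof.
split; last first.
  have h : e`_0 \in std a1 by rewrite std1E memv_line.
  by rewrite b_inv (standard_isotropic char_k mod_e b_inv h h).
apply: contraNneq e0_neq0 => h.
by rewrite -(repr_invK rho_repr g e`_0) h linear0.
Qed.

Let line_stable g : rho g e`_0 \in std a1 -> stabilizer rho (std a1) g.
Proof. by move=> h; apply: stabilizer_sub => //; rewrite std1E limg_line -memvE -std1E. Qed.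


Lemma triality_stabilizer d h : stabilizer rho (std d) h ->
  stabilizer rho (std (diagram_aut d)) (phi h).
Proof.
have ann3 z : z \in std a3 -> star z e`_0 = 0.
  move=> /(coord_span (X := in_tuple [seq e`_a | a <- standard_weights a3])) ->.
  rewrite linear_sumlz big1 // => i _; rewrite linearZl_LR /=.
  rewrite (_ : star _ _ = 0) ?scaler0 //.
  have /mapP[a aJ ->] := mem_nth 0 (ltn_ord i).
  have a8 : (a < 8)%N by have /allP/(_ _ aJ) : all (gtn 8) (standard_weights a3).
  rewrite starE // (_ : star_index a 0 = 8%N) ?weight_vector8 ?scaler0 //.
  by have /allP/(_ _ aJ)/eqP : all (fun a => star_index a 0 == 8%N) (standard_weights a3).
have ann4 z : z \in std a4 -> star e`_0 z = 0.
  move=> /(coord_span (X := in_tuple [seq e`_a | a <- standard_weights a4])) ->.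
  rewrite linear_sumr big1 // => i _; rewrite linearZr_LR /=.
  rewrite (_ : star _ _ = 0) ?scaler0 //.
  have /mapP[a aJ ->] := mem_nth 0 (ltn_ord i).
  have a8 : (a < 8)%N by have /allP/(_ _ aJ) : all (gtn 8) (standard_weights a4).
  rewrite starE // (_ : star_index 0 a = 8%N) ?weight_vector8 ?scaler0 //.
  by have /allP/(_ _ aJ)/eqP : all (fun a => star_index 0 a == 8%N) (standard_weights a4).
move: d; apply: I4P => st; rewrite ?diagram_autE.
- by rewrite /stabilizer -line_full st; case: std_products.
- by rewrite /stabilizer -plane st; case: std_products.
(* If [h] preserves e_0 * V, then phi^2(h) e_0 is annihilated by e_0 * V on its left, like e_0
   itself, so it lies on the line of e_0. *)
- have st1 : stabilizer rho (std a1) (phi (phi h)).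
    apply: line_stable; apply: (star_left_ann e_basis lam0 starE) => a aJ.
    have : e`_a \in std a3 by apply: mem_weight_span.
    rewrite -[std a3]st => /memv_imgP[z z3 ->].
    by rewrite star_inv ann3 // linear0.
  by rewrite /stabilizer -(phi3 (phi h)) -full_line st1; case: std_products.
- apply: line_stable; apply: (star_right_ann e_basis lam0 starE) => a aJ.
  have : e`_a \in std a4 by apply: mem_weight_span.
  rewrite -[std a4]st => /memv_imgP[z z4 ->].
  by rewrite -{2}(phi3 h) star_inv ann4 // linear0.
Qed.

(** Two more applications of the inclusion complete the cycle of [d] and give its converse. *)
Lemma triality_stabilizerP d h : stabilizer rho (std (diagram_aut d)) h <->
  exists2 h', stabilizer rho (std d) h' & h = phi h'.
Proof.
split=> [st|[h' st ->]]; last exact: triality_stabilizer.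
exists (phi (phi h)); rewrite ?phi3 //.
by rewrite -(diagram_aut3 d); do 2!apply: triality_stabilizer.
Qed.

Local Notation Gam := (object x rho e`_0).
Local Notation psi := (psi_graph x rho e`_0 b star).
Local Notation induced := (induced_graph x rho e`_0 phi).

Lemma delta_spaceP d W : delta_space x rho e`_0 d W <-> exists g, W = (rho g @: std d)%VS.
Proof.
split=> [[g [U [/(standard_spaceP xrel rho_repr mod_e) -> ->]]]|[g ->]]; first by exists g.
by exists g, (std d); split=> //; apply/(standard_spaceP xrel rho_repr mod_e).
Qed.

Lemma objectP W : Gam W <-> exists g d, W = (rho g @: std d)%VS.
Proof.
split=> [[d /delta_spaceP[g ->]]|[g [d ->]]]; first by exists g, d.
by exists d; apply/delta_spaceP; exists g.
Qed.

(** All four clauses of psi become one equivariant formula. The pair [g], [d] is not unique, so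
    single-valuedness is still to be proved, through stabilizers. *)
Lemma psi_graphP U W : psi U W <-> exists g d,
  U = (rho g @: std d)%VS /\ W = (rho (phi g) @: std (diagram_aut d))%VS.
Proof.
split=> [[a a0 baa|a a0 baa|a a0 baa|Z /delta_spaceP[g ->]]|[g [d [-> ->]]]].
- by have [g ->] := isotropic_line a0 baa; exists g, a1; rewrite line_full diagram_autE.
- have [g ->] := isotropic_line a0 baa; exists (phi g), a3.
  by rewrite line_full full_line diagram_autE.
- have [g ->] := isotropic_line a0 baa; exists (phi (phi g)), a4.
  by rewrite full_line diagram_autE phi3.
- by exists g, a2; rewrite plane diagram_autE.
have line h : (rho h @: std a1 = <[rho h e`_0]>)%VS by rewrite std1E limg_line.
move: d; apply: I4P; rewrite ?diagram_autE.
- rewrite -line_full line; have [? ?] := line_isotropic g; exact: psi_line.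
- rewrite -plane; apply: psi_plane; apply/delta_spaceP; by exists g.
- have -> : (rho g @: std a3 = spprod star <[rho (phi (phi g)) e`_0]> fullv)%VS.
    by rewrite -line line_full phi3.
  have -> : (rho (phi g) @: std a4 = spprod star fullv <[rho (phi (phi g)) e`_0]>)%VS.
    by rewrite -line full_line phi3.
  by have [? ?] := line_isotropic (phi (phi g)); apply: psi_left.
- have -> : (rho g @: std a4 = spprod star fullv <[rho (phi g) e`_0]>)%VS.
    by rewrite -line full_line phi3.
  rewrite line; by have [? ?] := line_isotropic (phi g); apply: psi_right.
Qed.

Lemma stabilizer_eq U W : Gam U -> Gam W ->
  (forall h, stabilizer rho U h <-> stabilizer rho W h) -> U = W.
Proof.
move=> /objectP[g [d ->]] /objectP[g' [d' ->]].
exact: (stabilizer_inj char_k rho_repr mod_e b_inv b_nondeg).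
Qed.

Lemma psi_induced U W : psi U W <-> induced U W.
Proof.
have psi_ind U' W' : psi U' W' -> induced U' W'.
  move=> /psi_graphP[g [d [-> ->]]]; split; try by apply/objectP; do 2!eexists.
  move=> h; rewrite stabilizer_conj // triality_stabilizerP.
  split=> [[h' st e']|[h' st ->]].
    exists (g * h' * g^-1)%g.
      by rewrite stabilizer_conj // !mulgA mulVg mul1g -mulgA mulVg mulg1.
    by rewrite !gmulfM -e' multiplicativeV !mulgA mulgV mul1g -mulgA mulgV mulg1.
  exists (g^-1 * h' * g)%g; first by apply/stabilizer_conj.
  by rewrite !gmulfM multiplicativeV.
split=> [/psi_ind //|[GU GW st]]; have /objectP[g [d Ud]] := GU.
have p : psi U (rho (phi g) @: std (diagram_aut d))%VS by apply/psi_graphP; exists g, d.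
suff -> : W = (rho (phi g) @: std (diagram_aut d))%VS by [].
have [_ GW' st'] := psi_ind _ _ p.
by apply: stabilizer_eq => // h; rewrite st st'.
Qed.

Lemma psi_stabilizer U W h : psi U W -> stabilizer rho U h <-> stabilizer rho W (phi h).
Proof.
move=> /psi_induced[_ _ st]; rewrite st; split=> [hU|[h' hU]]; first by exists h.
by move/(congr1 (phi \o phi)) => /=; rewrite !phi3 => ->.
Qed.

Lemma psi_map : is_map_on Gam psi.
Proof.
split=> [U W /psi_induced[] //|U GU]; have /objectP[g [d Ud]] := GU.
have p : psi U (rho (phi g) @: std (diagram_aut d))%VS by apply/psi_graphP; exists g, d.
exists (rho (phi g) @: std (diagram_aut d))%VS; split=> // W pW.
have [_ GW st] := iffLR (psi_induced _ _) p; have [_ GW' st'] := iffLR (psi_induced _ _) pW.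
by apply: stabilizer_eq => // h; rewrite st st'.
Qed.

Lemma psi_automorphism : is_geometry_automorphism Gam (incident x rho) psi.
Proof.
split=> [|W GW|U U' W W' p p']; first exact: psi_map.
  have /objectP[g [d Wd]] := GW.
  have p : psi (rho (phi (phi g)) @: std (diagram_aut (diagram_aut d)))%VS W.
    apply/psi_graphP; exists (phi (phi g)), (diagram_aut (diagram_aut d)).
    by rewrite phi3 diagram_aut3.
  exists (rho (phi (phi g)) @: std (diagram_aut (diagram_aut d)))%VS; split=> // U pU.
  have [GU _ _] := iffLR (psi_induced _ _) p; have [GU' _ _] := iffLR (psi_induced _ _) pU.
  by apply: stabilizer_eq => // h; rewrite (psi_stabilizer h p) (psi_stabilizer h pU).
split=> -[P [Ppar PP]].
  (* This is the image of [P] under phi; the other direction takes the preimage. *)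
  exists (fun h => P (phi (phi h))); split.
    exact: (triality_parabolic xrel phi_triality (triality_parabolic xrel phi_triality Ppar)).
  move=> h /PP[]; rewrite (psi_stabilizer _ p) (psi_stabilizer _ p') phi3.
  by [].
exists (fun h => P (phi h)); split; first exact: (triality_parabolic xrel phi_triality Ppar).
by move=> h /PP[]; rewrite (psi_stabilizer _ p) (psi_stabilizer _ p').
Qed.
End Psi.

Theorem mainTheorem3
  (k : fieldType) (char_k : [pchar k] =i pred0)
  (G : groupType) (x : rootlat -> k -> G)
  (G_D4 : split_simply_connected_D4 x)
  (V : vectType k) (dimV : \dim {:V} = 8%N)
  (rho0 : G -> 'End(V))
  (rho0_repr : representation rho0) (rho0_rational : rational x rho0)
  (rho0_irr : irreducible rho0)
  (v : V)
  (v_highest : highest_weight_vector x rho0 (fundamental_weight a1) v)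
  (phi : {multiplicative G -> G}) (phiV : G -> G)
  (phi_triality : triality x phi)
  (phiK : cancel phi phiV) (phiVK : cancel phiV phi)
  (b : {biscalar V})
  (b_sym : forall u w, b u w = b w u)
  (b_nondeg : nondegenerate_form b)
  (b_inv : forall g u w, b (rho0 g u) (rho0 g w) = b u w)
  (t : V -> V -> V -> k) (t_trilinear : trilinear t)
  (t_neq0 : exists x0 x1 x2, t x0 x1 x2 <> 0)
  (t_inv : forall g x0 x1 x2,
     t (rho0 g x0) (twist rho0 phiV 1 g x1) (twist rho0 phiV 2 g x2) =
     t x0 x1 x2)
  (star : {bilinear V -> V -> V})
  (starE : forall x0 x1 x2, t x0 x1 x2 = b x0 (star x1 x2)) :
  let Gam := object x rho0 v in
  let psi := psi_graph x rho0 v b star in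
  [/\ is_map_on Gam psi,
      is_geometry_automorphism Gam (incident x rho0) psi
    & forall X Y, psi X Y <-> induced_graph x rho0 v phi X Y].
Proof.
have xrel := sc_relations G_D4.
have [e [X [Y [<- mod_e]]]] :=
  model_exists char_k xrel rho0_repr dimV rho0_rational rho0_irr (sc_generated G_D4) v_highest.
have phiVE g : phiV g = phi (phi g).
  by rewrite -{1}(triality_order3 phi_triality g) phiK.
(* Invariance of [t] is used at phi(g), where the three representations take the values at phi(g), g
   and phi^2(g); nondegeneracy of [b] removes the first argument. *)
have star_inv g u w : star (rho0 g u) (rho0 (phi (phi g)) w) = rho0 (phi g) (star u w).
  apply/eqP; rewrite -subr_eq0; apply/eqP/b_nondeg => z.
  rewrite b_sym linearBr /= -(repr_Kinv rho0_repr (phi g) z) b_inv -!starE.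
  by rewrite -(t_inv (phi g) _ u w) /twist /= phiK phiVE subrr.
have star_neq0 : exists u w, star u w != 0.
  case: t_neq0 => x0 [x1 [x2 t0]]; exists x1, x2; apply/eqP => s0; apply: t0.
  by rewrite starE s0 linear0r.
move=> Gam psi; split.
- exact: (psi_map char_k xrel rho0_repr mod_e phi_triality b_inv b_nondeg star_inv star_neq0).
- exact: (psi_automorphism char_k xrel rho0_repr mod_e phi_triality b_inv b_nondeg star_inv star_neq0).
- exact: (psi_induced char_k xrel rho0_repr mod_e phi_triality b_inv b_nondeg star_inv star_neq0).
Qed.
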